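(* Let $K$ be a field, let $\mathcal A\subseteq M_{\alpha,d}$ define the simplicial toric ideal $I_{\mathcal A}\subset K[x_1,\dots,x_c,y_1,\dots,y_d]$, let $S$ be the semigroup generated by $\mathcal A$, and let $\mathcal P\subset\mathbb R^d$ be the convex hull of $\mathcal A$. Assume that $\deg K[S]=\alpha^{d-1}$ and that there exists an edge of $\mathcal P$ such that either this edge is full, or at least $\left(\frac34+\frac1{4d}\right)\alpha+2$ integer points on it belong to $\mathcal A$. Then the maximum degree in a minimal Gröbner basis of $I_{\mathcal A}$ with respect to the reverse lexicographic order is at most $\deg K[S]-\operatorname{codim}K[S]+1$.
   Context: Setting. $K$ is an arbitrary field, $c\ge 2$, $\alpha\ge 2$ and $d$ are natural numbers, and $M_{\alpha,d}=\{(x_1,\dots,x_d)\in\mathbb N^d : x_1+\cdots+x_d=\alpha\}$ (with $0\in\mathbb N$). $\mathcal A=\{\mathbf e_1,\dots,\mathbf e_d,\mathbf a_1,\dots,\mathbf a_c\}\subseteq M_{\alpha,d}$ is a set of $d+c$ distinct elements, where $\mathbf e_1=(\alpha,0,\dots,0),\dots,\mathbf e_d=(0,\dots,0,\alpha)$. Writing $\mathbf a_i=(a_{i1},\dots,a_{id})$, the integers $a_{ij}$ ($1\le i\le c$, $1\le j\le d$) are assumed to be relatively prime (their overall gcd is $1$). $S\subseteq\mathbb N^d$ is the (homogeneous simplicial affine) semigroup (with $0$) generated by $\mathcal A$, and $K[S]\cong K[t_1^\alpha,\dots,t_d^\alpha,\mathbf t^{\mathbf a_1},\dots,\mathbf t^{\mathbf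 a_c}]\subseteq K[t_1,\dots,t_d]$, where $\mathbf t^{\mathbf a_i}=t_1^{a_{i1}}\cdots t_d^{a_{id}}$. $I_{\mathcal A}$ is the kernel of the $K$-algebra homomorphism $K[x_1,\dots,x_c,y_1,\dots,y_d]\to K[S]$, $x_i\mapsto \mathbf t^{\mathbf a_i}$, $y_j\mapsto t_j^\alpha$; it is called the simplicial toric ideal defined by $\mathcal A$. The grading is the standard one: $\deg x_i=\deg y_j=1$. One has $\dim K[S]=d$ and $\operatorname{codim}K[S]=c$; $\deg K[S]$ is the multiplicity of the standard graded algebra $K[S]$. Order. The reverse lexicographic order is the graded (degree) reverse lexicographic order with $x_1>\cdots>x_c>y_1>\cdots>y_d$. The maximum degree in a minimal Gröbner basis of $I_{\mathcal A}$ is the largest degree of a minimal generator of the initial ideal $\operatorname{in}(I_{\mathcal A})$. Faces. $\mathcal P$ is a $(d-1)$-dimensional polytope (the simplex with vertices $\mathbf e_1,\dots,\mathbf e_d$) whose faces $\mathcal P_I$ are spanned by the sets $\mathcal A_I=\{\mathbf a\in\mathcal A : a_i=0 \text{ for all } i\in I\}$, $I\subseteq\{1,\dots,d\}$. An edge is a $1$-dimensional face. A face $\mathcal P_I$ is called full if $\mathcal A_I=\mathcal P_I\cap M_{\alpha,d}$, i.e. $\mathcal A$ contains all points of $M_{\alpha,d}$ lying on this face. *)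

(* Defs.v *)
From mathcomp Require Import all_boot all_order all_algebra.
From mathcomp Require Export mpoly.

Set Implicit Arguments.
Unset Strict Implicit.
Unset Printing Implicit Defensive.

Import Order.TTheory GRing.Theory Num.Theory.
Local Open Scope ring_scope.

(* Exponent vectors in N^d are represented by 'X_{1..d}, so that mdeg x is the
   coordinate sum and M_{alpha,d} is the set of x with mdeg x = alpha. *)

(* The set A as a family indexed like the variables of K[x_1..x_c,y_1..y_d]:
   the c elements a_i first, then the d vertices alpha * (unit vector j). *)
Definition generator (c d alpha : nat) (a : 'I_c -> 'X_{1..d})
    (v : 'I_(c + d)) : 'X_{1..d} :=
  match split v with
  | inl i => a i
  | inr j => (U_(j) *+ alpha)%MM
  end.

(* I_A as the kernel of K[x,y] -> K[t]; the image of this map is K[S], so that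
   the invariants of K[S] below are those of the quotient of K[x,y] by I_A. *)
Definition toric_ideal (K : fieldType) (c d alpha : nat)
    (a : 'I_c -> 'X_{1..d}) : {pred {mpoly K[c + d]}} :=
  [pred p | p \mPo [tuple 'X_[generator alpha a v] | v < c + d] == 0].

Arguments toric_ideal K {c d} alpha a.

Section GradedQuotients.

Variables (K : fieldType) (n : nat) (I : {pred {mpoly K[n]}}).

(* r is the K-dimension of the degree s part of K[X]/I: there are r forms of
   degree s whose classes are a basis of it (I is meant to be homogeneous). *)
Definition hilbert_function (s r : nat) : Prop :=
  exists b : 'I_r -> {mpoly K[n]},
    [/\ forall i, b i \is s.-homog,
        forall l : 'I_r -> K, \sum_i l i *: b i \in I -> forall i, l i = 0
      & forall p, p \is s.-homog ->
          exists l : 'I_r -> K, p - \sum_i l i *: b i \in I].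

Definition hilbert_polynomial (P : {poly rat}) : Prop :=
  exists s0 : nat, forall s, (s0 <= s)%N ->
    exists2 r, hilbert_function s r & P.[s%:R] = r%:R.

(* For dim K[X]/I >= 1, i.e. P != 0. *)
Definition multiplicity (e : nat) : Prop :=
  exists P : {poly rat},
    [/\ P != 0, hilbert_polynomial P
      & e%:R = ((size P).-1)`!%:R * lead_coef P].

Definition prime_ideal (J : {pred {mpoly K[n]}}) : Prop :=
  idealr_closed J /\ prime_idealr_closed J.

(* A chain P_0 < ... < P_m of primes containing I, i.e. of primes of K[X]/I. *)
Definition prime_chain (m : nat) : Prop :=
  exists P : nat -> {pred {mpoly K[n]}},
    (forall i, (i <= m)%N -> prime_ideal (P i) /\ {subset I <= P i}) /\
    (forall i, (i < m)%N ->
       {subset P i <= P i.+1} /\ ~ {subset P i.+1 <= P i}).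

Definition krull_dim (m : nat) : Prop :=
  prime_chain m /\ forall m', prime_chain m' -> (m' <= m)%N.

Definition codim (k : nat) : Prop :=
  exists2 m, krull_dim m & (m + k)%N = n.

End GradedQuotients.

Section InitialIdeal.

Variables (K : fieldType) (n : nat).

(* Graded reverse lexicographic order with X_0 > X_1 > ... > X_(n-1).  The
   order (_ <= _)%O that mpoly puts on monomials (the one used by mlead) breaks
   ties of degree lexicographically, so it cannot be used here. *)
Definition grevlex_lt (m1 m2 : 'X_{1..n}) : bool :=
  (mdeg m1 < mdeg m2)%N ||
  (mdeg m1 == mdeg m2) &&
  [exists i : 'I_n, (m2 i < m1 i)%N &&
     [forall j : 'I_n, (i < j)%N ==> (m1 j == m2 j)]].

Definition leading_monomial (p : {mpoly K[n]}) (m : 'X_{1..n}) : Prop :=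
  m \in msupp p /\
  forall m', m' \in msupp p -> m' != m -> grevlex_lt m' m.

Definition initial_ideal (I : {pred {mpoly K[n]}}) (q : {mpoly K[n]}) : Prop :=
  exists (r : nat) (h : 'I_r -> {mpoly K[n]}) (m : 'I_r -> 'X_{1..n}),
    (forall i, exists2 p, p \in I & leading_monomial p (m i)) /\
    q = \sum_i h i * 'X_[m i].

Definition minimal_generator (J : {mpoly K[n]} -> Prop) (m : 'X_{1..n}) : Prop :=
  J 'X_[m] /\ forall m', (m' <= m)%MM -> J 'X_[m'] -> m' = m.

(* D is the maximum degree in a minimal Groebner basis of I. *)
Definition max_groebner_degree (I : {pred {mpoly K[n]}}) (D : nat) : Prop :=
  (exists2 m, minimal_generator (initial_ideal I) m & mdeg m = D) /\
  (forall m, minimal_generator (initial_ideal I) m -> (mdeg m <= D)%N).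

End InitialIdeal.

Section Faces.

(* R plays the role of the real numbers. *)
Variables (R : realFieldType) (d : nat).

Definition point (x : 'X_{1..d}) : 'rV[R]_d := \row_j (x j)%:R.

Definition in_convex_hull (s : seq 'X_{1..d}) (u : 'rV[R]_d) : Prop :=
  exists w : 'X_{1..d} -> R,
    [/\ forall x, x \in s -> 0 <= w x,
        \sum_(x <- s) w x = 1
      & u = \sum_(x <- s) w x *: point x].

(* Dimension of the direction space of the affine hull of s (s nonempty). *)
Definition hull_dim (s : seq 'X_{1..d}) : nat :=
  \dim <<[seq point x - point y | x <- s, y <- s]>>%VS.

Variables (c alpha : nat) (a : 'I_c -> 'X_{1..d}).

(* A_I; the face P_I is its convex hull. *)
Definition face_points (I : {set 'I_d}) : seq 'X_{1..d} :=
  [seq x : 'X_{1..d} <- codom (generator alpha a) |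
     [forall i in I, x i == 0%N]].

Definition is_edge (I : {set 'I_d}) : Prop := hull_dim (face_points I) = 1%N.

Definition full_face (I : {set 'I_d}) : Prop :=
  forall x : 'X_{1..d}, x \in face_points I <->
    (mdeg x = alpha /\ in_convex_hull (face_points I) (point x)).

End Faces.

(* Main.v *)
Require Import Defs.
From HB Require Import structures.
From mathcomp Require Import all_boot all_order all_algebra.
From mathcomp Require Import zify lra.
From Stdlib Require Import Classical.
Set Implicit Arguments.
Unset Strict Implicit.
Unset Printing Implicit Defensive.
Import Order.TTheory GRing.Theory Num.Theory.
Local Open Scope ring_scope.

(** The ideal is spanned by binomials, so a minimal generator x^u y^v of the
    initial ideal is the larger term of a binomial x^u y^v - x^u' y^v' in the
    ideal, and the second term can be chosen standard, that is, outside the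
    initial ideal.  Minimality makes the two terms coprime.  Call a sequence s
    of the points a_i irreducible when its sum is not a sum of points a_i plus
    alpha * w for a nonzero w; every such rewriting puts x^s in the initial
    ideal, because the y's are the smallest variables.

    If v = 0, then u without one variable is irreducible.  If v <> 0, then
    v' <> 0 as well, u and u' are irreducible, and comparing coordinates on the
    support of v gives |v| < |u'|, hence degree at most |u| + |u'| - 1.  So the
    theorem reduces to bounding the length of irreducible sequences.

    Drop one coordinate and reduce modulo alpha: the points land in the group
    G = (Z/alpha)^(d-1), of order deg K[S], where the vertices become 0.  In an
    irreducible sequence no nonempty subsum vanishes, and no subsum of at least
    two terms lies in the set of residues of the generators (c + 1 elements,
    0 included).  The partial sums of length at least 2 are therefore distinct
    elements outside this set, so |u| <= deg - c (irreducible_size); this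
    settles v = 0.

    For v <> 0 one wants 2 |u| <= deg - c + 2, which is where the edge enters
    (irreducible_size_edge, for d >= 3).  Let L be the cyclic subgroup of order
    alpha given by the edge and let g be its number of gaps, the elements of L
    that are no residue of a generator; the hypothesis says that g = 0 or
    4 (g + 1) < alpha.  Between two visits to the same coset of L the partial
    sums pick up a nonzero element of L which is a sum of at least two terms,
    hence a gap, and all the gaps obtained in this way are distinct: a coset is
    visited at most g + 1 times.  On the other hand a coset contains at least
    as many non-residues as its coordinates outside the edge sum up to, minus
    one, since a residue of a generator has coordinate sum at most alpha.
    Summing over the cosets shows that the non-residues outnumber twice the
    visits up to a constant (few_kernel_terms_le).  If g = 0 the few cosets
    with a deficit need a closer look (no_gap_count_le,
    binary_full_edge_size).

    For d = 2 there is no room for that count.  But an irreducible sequence of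
    at least three points then has a total that is close to a multiple of one
    of the two vertices (irreducible_one_sided), and two such sequences cannot
    be linked by a binomial with v and v' nonzero; so |u| <= 2 or |u'| <= 2.

    Finally codim K[S] <= c follows from the chain of primes obtained by
    killing t_1, t_2, ... one after the other (prime_chain_toric). *)

(** * Zero-sum free sequences and cosets of a kernel *)

Section Avoiding.

Variables (T : eqType) (G : finZmodType) (f : T -> G) (B : {set G}).

Definition psum (w : seq T) (j : nat) : G := \sum_(x <- take j w) f x.

(** Quantifying over splittings of w up to permutation makes the property
    stable under taking subsequences and reordering. *)
Definition avoids (w : seq T) : Prop :=
  forall P Q, perm_eq (P ++ Q) w -> P != [::] ->
    \sum_(x <- P) f x != 0 /\
    ((1 < size P)%N -> \sum_(x <- P) f x \notin B).

Lemma avoids_part (w P Q : seq T) :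
  avoids w -> perm_eq (P ++ Q) w -> avoids P.
Proof.
move=> Hw HPQ P1 Q1 H1 nz; apply: (Hw P1 (Q1 ++ Q)) => //.
by apply: perm_trans HPQ; rewrite catA perm_cat2r.
Qed.

Lemma psum_cat (u w : seq T) (j : nat) :
  psum (u ++ w) (size u + j) = \sum_(x <- u) f x + psum w j.
Proof. by rewrite /psum take_cat ltnNge leq_addr /= addKn big_cat. Qed.

Lemma psum_drop (w : seq T) (i j : nat) :
  psum w (i + j) = psum w i + psum (drop i w) j.
Proof. by rewrite /psum takeD big_cat. Qed.

Lemma psum1 (x : T) (w : seq T) : psum (x :: w) 1 = f x.
Proof. by rewrite /psum /= take0 big_seq1. Qed.

(** Two partial sums differ by the sum of a nonempty block of terms. *)
Lemma psum_neq (w : seq T) (i j : nat) :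
  avoids w -> (i < j <= size w)%N -> psum w i != psum w j.
Proof.
move=> Hw /andP[ij jw]; rewrite -(subnKC (ltnW ij)) psum_drop.
set P := take (j - i) (drop i w).
have szP : size P = (j - i)%N by rewrite size_takel // size_drop leq_sub2r.
have [| |Hnz _] := Hw P (take i w ++ drop (j - i) (drop i w)).
- by rewrite perm_catCA cat_take_drop cat_take_drop.
- by rewrite -size_eq0 szP subn_eq0 -ltnNge.
by apply: contra Hnz; rewrite -{1}[psum w i]addr0 => /eqP/addrI/esym/eqP.
Qed.

Lemma psum_notin (w : seq T) (j : nat) :
  avoids w -> (1 < j <= size w)%N -> psum w j \notin B.
Proof.
move=> Hw /andP[j1 jw]; have sz : size (take j w) = j by rewrite size_takel.
have [| |_ H] := Hw (take j w) (drop j w); first by rewrite cat_take_drop.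
  by rewrite -size_eq0 sz; case: (j) j1.
by apply: H; rewrite sz.
Qed.

(** The counting principle behind every bound below: partial sums are
    distinct, so a set contains at least as many elements as it is visited. *)
Lemma count_psum_le (w : seq T) (C : {set G}) :
  avoids w -> (count (fun j => psum w j \in C) (iota 1 (size w)) <= #|C|)%N.
Proof.
move=> Hw; rewrite -size_filter -(size_map (psum w)) cardE.
apply: uniq_leq_size => [|x /mapP[j]]; last first.
  by rewrite mem_filter => /andP[Hj _] ->; rewrite mem_enum.
rewrite map_inj_in_uniq ?filter_uniq ?iota_uniq // => i j.
rewrite !mem_filter !mem_iota => /and3P[_ i1 iw] /and3P[_ j1 jw] E.
have [ij|ji|//] := ltngtP i j.
  by have/eqP[] := @psum_neq w i j Hw (ltac:(lia)).
by have/eqP[] := @psum_neq w j i Hw (ltac:(lia)).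
Qed.

Lemma avoids_size (w : seq T) : avoids w -> (size w <= #|~: B|.+1)%N.
Proof.
move=> Hw; have := count_psum_le (~: B) Hw.
case E: (size w) => [//|n] /=; suff -> : count (fun j => psum w j \in ~: B)
   (iota 2 n) = n by lia.
rewrite -[RHS](size_iota 2) -(count_predT (iota 2 n)); apply: eq_in_count => j.
rewrite mem_iota in_setC => Hj; rewrite psum_notin // E; lia.
Qed.

End Avoiding.

(** The terms of the sequence are sorted into those that lie in the kernel of
    pi (ls) and those that do not (bs); cosets of the kernel are named by their
    image under pi. *)
Section Cosets.

Variables (T : eqType) (G : finZmodType) (f : T -> G) (B : {set G}).
Variable pi : {additive G -> G}.
Variables bs ls : seq T.
Hypothesis bsP : forall x, x \in bs -> pi (f x) != 0.
Hypothesis lsP : forall x, x \in ls -> pi (f x) = 0.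
Hypothesis av : avoids f B (bs ++ ls).

Definition miss (gamma : G) : {set G} := [set x | (pi x == gamma) && (x \notin B)].
Definition hits (gamma : G) : nat :=
  count (fun j => pi (psum f bs j) == gamma) (iota 1 (size bs)).

Let av_bs : avoids f B bs.
Proof. exact: avoids_part av (perm_refl _). Qed.

Lemma pi_psum_ls (j : nat) : pi (psum f ls j) = 0.
Proof.
rewrite /psum raddf_sum big_seq big1 // => x /mem_take; exact: lsP.
Qed.

Lemma sum_miss : (\sum_gamma #|miss gamma| = #|~: B|)%N.
Proof.
rewrite -[RHS]sum1_card [RHS](partition_big pi xpredT) //=.
apply: eq_bigr => g _.
by rewrite -sum1_card; apply: eq_bigl => x; rewrite !inE andbC.
Qed.

Lemma sum_hits : (\sum_gamma hits gamma = size bs)%N.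
Proof.
rewrite -[RHS](size_iota 1) /hits.
elim: (iota 1 (size bs)) => [|j s IH] /=; first by rewrite big1.
rewrite big_split /= IH (bigD1 (pi (psum f bs j))) //= eqxx big1 ?addn0 //.
by move=> g /negbTE; rewrite eq_sym => ->.
Qed.

(** Each visit after the first term produces an element outside B; the first
    partial sum is a single term, which B may contain. *)
Lemma miss_ge_hits (gamma : G) :
  (hits gamma <= #|miss gamma| + (gamma == pi (psum f bs 1)))%N.
Proof.
apply: leq_trans (leq_add (count_psum_le (miss gamma) av_bs) (leqnn _)).
rewrite /hits; case E: (size bs) => [//|n] /=.
rewrite [gamma == _]eq_sym.
suff -> : count (fun j => pi (psum f bs j) == gamma) (iota 2 n) =
  count (fun j => psum f bs j \in miss gamma) (iota 2 n) by rewrite addnAC leq_add2r leq_addl.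
apply: eq_in_count => j.
rewrite mem_iota inE => Hj; rewrite (psum_notin av_bs) ?andbT // E; lia.
Qed.

Lemma kernel_terms_le : (size ls <= #|miss 0%R|.+1)%N.
Proof.
have avl : avoids f B ls.
  by apply: (avoids_part av (Q := bs)); rewrite perm_catC.
have := count_psum_le (miss 0%R) avl.
case E: (size ls) => [//|n] /=.
suff -> : count (fun j => psum f ls j \in miss 0%R) (iota 2 n) = n by lia.
rewrite -[RHS](size_iota 2) -(count_predT (iota 2 n)); apply: eq_in_count => j.
rewrite mem_iota !inE pi_psum_ls eqxx => Hj /=; rewrite (psum_notin avl) // E.
lia.
Qed.

(** A return to the kernel takes at least two terms, since no single term
    lies in it; so the partial sum is outside B at that moment. *)
Lemma returns_le (w : seq T) : avoids f B w ->
  (forall x, x \in w -> pi (f x) != 0) ->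
  (count (fun j => pi (psum f w j) == 0%R) (iota 1 (size w)) <= #|miss 0%R|)%N.
Proof.
move=> Hw wP; apply: leq_trans (count_psum_le (miss 0%R) Hw).
rewrite leq_eqVlt; apply/orP; left; apply/eqP; apply: eq_in_count => j.
rewrite mem_iota inE => /andP[j1 jw]; case: eqP => //= E.
suff j2 : (1 < j)%N by rewrite (psum_notin Hw) //; lia.
rewrite ltn_neqAle j1 andbT; apply/eqP => Ej; move: E jw.
case: w Hw wP => [|x w] Hw wP; rewrite -Ej //= psum1 => E _.
by have/eqP[] := wP x (mem_head _ _).
Qed.

(** After the first visit to a coset, later visits are returns to the kernel
    for the remaining terms. *)
Lemma hits_le (gamma : G) : (hits gamma <= #|miss 0%R|.+1)%N.
Proof.
suff H w : avoids f B w -> (forall x, x \in w -> pi (f x) != 0) ->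
   forall gamma, (count (fun j => pi (psum f w j) == gamma) (iota 1 (size w))
   <= #|miss 0%R|.+1)%N by exact: H.
elim: w => [//|x w IH] Hw wP g /=.
have Hw' : avoids f B w.
  by apply: (avoids_part Hw (Q := [:: x])); rewrite perm_catC.
have wP' y : y \in w -> pi (f y) != 0 by move=> yw; apply: wP; rewrite inE yw orbT.
have -> : count (fun j => pi (psum f (x :: w) j) == g) (iota 2 (size w)) =
   count (fun j => pi (psum f w j) == g - pi (f x)) (iota 1 (size w)).
  rewrite -(addn1 1) iotaDl count_map; apply: eq_count => j /=.
  by rewrite -[x :: w]cat1s -[1%N]/(size [:: x]) psum_cat big_seq1 raddfD /=
     addrC [RHS]eq_sym subr_eq [RHS]eq_sym.
have [E|_] := eqVneq (pi (psum f (x :: w) 1)) g; last exact: IH.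
rewrite -E psum1 subrr add1n ltnS; exact: returns_le.
Qed.

(** Once the partial sums have returned to the kernel, appending the kernel
    terms one by one produces further elements of the kernel outside B.  The
    induction strips terms from the end until a return is the last step. *)
Lemma returns_kernel_terms_le (w : seq T) : avoids f B (w ++ ls) ->
  (forall x, x \in w -> pi (f x) != 0) ->
  (0 < count (fun j => pi (psum f w j) == 0%R) (iota 1 (size w)))%N ->
  (count (fun j => pi (psum f w j) == 0%R) (iota 1 (size w)) + size ls
     <= #|miss 0%R|)%N.
Proof.
elim/last_ind: w => [//|w x IH] Hw wP.
have wP' y : y \in w -> pi (f y) != 0.
  by move=> yw; apply: wP; rewrite mem_rcons inE yw orbT.
have avw : avoids f B (w ++ ls).
  apply: (avoids_part Hw (Q := [:: x])).
  by rewrite perm_sym -cats1 -!catA perm_cat2l perm_catC.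
rewrite size_rcons -[(size w).+1]addn1 iotaD count_cat /= addn0 add1n.
have Elast : psum f (rcons w x) (size w).+1 = \sum_(y <- rcons w x) f y.
  by rewrite /psum -(size_rcons w x) take_size.
rewrite Elast.
set u := count _ _; set v := nat_of_bool _.
have Eu : u = count (fun j => pi (psum f w j) == 0%R) (iota 1 (size w)).
  apply: eq_in_count => j; rewrite mem_iota => Hj; congr (pi _ == _).
  by rewrite -cats1 /psum takel_cat //; lia.
have [E|E] := eqVneq (pi (\sum_(y <- rcons w x) f y)) 0; last first.
  by rewrite /v (negbTE E) addn0 Eu; exact: IH.
move=> _; have {v}-> : v = 1%N by rewrite /v E eqxx.
apply: leq_trans (count_psum_le (miss 0%R) Hw).
rewrite size_cat size_rcons iotaD count_cat leq_add //; last first.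
  rewrite -[leqLHS](size_iota (1 + (size w).+1)) -count_predT.
  rewrite leq_eqVlt; apply/orP; left; apply/eqP; apply: eq_in_count => j.
  rewrite mem_iota inE => /andP[j1 j2].
  have Ej : j = (size (rcons w x) + (j - (size w).+1))%N by rewrite size_rcons; lia.
  have Epi : pi (psum f (rcons w x ++ ls) j) = 0.
    by rewrite Ej psum_cat raddfD /= E pi_psum_ls addr0.
  rewrite inE Epi eqxx /= (psum_notin Hw) // size_cat size_rcons.
  have w0 : (0 < size w)%N.
    rewrite lt0n; apply: contraNneq (wP x _) => [/size0nil w0|].
      by move: E; rewrite w0 big_seq1 => ->.
    by rewrite mem_rcons mem_head.
  lia.
have avr : avoids f B (rcons w x) by exact: avoids_part Hw (perm_refl _).
rewrite -[(size w).+1]addn1 iotaD count_cat /= addn0 add1n.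
have EE : psum f (rcons w x ++ ls) (size w).+1 = \sum_(y <- rcons w x) f y.
  by rewrite /psum takel_cat ?size_rcons // -(size_rcons w x) take_size.
rewrite leq_add //; last first.
  rewrite inE EE E eqxx /=.
  rewrite -Elast (psum_notin avr) // size_rcons. 
  case: w E wP {IH Hw wP' avw u Eu avr EE Elast} => [|y w'] /=; last by move=> *; lia.
  by rewrite big_seq1 => E /(_ x (mem_head _ _)); rewrite E eqxx.
rewrite leq_eqVlt; apply/orP; left; apply/eqP; apply: eq_in_count => j.
rewrite mem_iota inE => /andP[j1 jw].
have -> : psum f (rcons w x ++ ls) j = psum f (rcons w x) j.
  by rewrite /psum takel_cat ?size_rcons //; lia.
case: eqP => //= E'.
suff j2 : (1 < j)%N by rewrite (psum_notin avr) ?size_rcons //; lia.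
rewrite ltn_neqAle j1 andbT; apply/eqP => Ej; move: E' jw.
rewrite -Ej -cats1; case: w wP' {E IH Hw wP avw u Eu avr EE Elast} => [|y w] wP' //=.
by rewrite psum1 => E' _; have/eqP[] := wP' y (mem_head _ _).
Qed.

Lemma hits0_kernel_terms_le : (0 < hits 0%R)%N -> (hits 0%R + size ls <= #|miss 0%R|)%N.
Proof. exact: returns_kernel_terms_le. Qed.

(** One more kernel term than there are gaps exhausts the gaps: no coset can
    then be visited twice, and each visited coset contains the translates of
    its partial sum by all the partial sums of kernel terms. *)
Section ManyKernelTerms.

Hypothesis lsE : size ls = #|miss 0%R|.+1.

Lemma no_return (i j : nat) : (i < j <= size bs)%N ->
  pi (psum f bs i) != pi (psum f bs j).
Proof.
move=> /andP[ij jb]; apply/eqP => E.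
set P := take (j - i) (drop i bs).
have szP : size P = (j - i)%N by rewrite size_takel // size_drop leq_sub2r.
have avP : avoids f B (P ++ ls).
  apply: (avoids_part av (Q := take i bs ++ drop (j - i) (drop i bs))).
  apply/permP => r; rewrite -{3}(cat_take_drop i bs).
  by rewrite -{2}(cat_take_drop (j - i) (drop i bs)) -/P !count_cat; lia.
have PP x : x \in P -> pi (f x) != 0.
  by move=> /mem_take/mem_drop; exact: bsP.
suff : (0 < count (fun j => pi (psum f P j) == 0%R) (iota 1 (size P)))%N.
  by move=> /(returns_kernel_terms_le avP PP); rewrite lsE; lia.
rewrite -has_count; apply/hasP; exists (size P).
  by rewrite mem_iota szP; lia.
have : psum f bs j = psum f bs i + psum f P (size P).
  by rewrite /P /psum take_size -big_cat -takeD subnKC // ltnW.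
move=> /(congr1 pi); rewrite raddfD -E /= => /eqP.
by rewrite addrC -subr_eq subrr eq_sym.
Qed.

Lemma kernel_terms_hits_le (gamma : G) :
  ((size ls).+1 * hits gamma <= #|miss gamma| + (gamma == pi (psum f bs 1)))%N.
Proof.
have [->|h0] := posnP (hits gamma); first by rewrite muln0.
move: (h0); rewrite /hits -has_count => /hasP[j].
rewrite mem_iota => Hj /eqP Ej.
have -> : count (fun j => pi (psum f bs j) == gamma) (iota 1 (size bs)) = 1%N.
  apply/eqP; rewrite eqn_leq [(0 < _)%N]h0 andbT -size_filter; apply: (@leq_trans (size [:: j])) => //.
  apply: uniq_leq_size; first by rewrite filter_uniq ?iota_uniq.
  move=> i; rewrite mem_filter mem_iota inE => /andP[/eqP Ei Hi].
  have [ij|ji|//] := ltngtP i j.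
    by have := @no_return i j (ltac:(lia)); rewrite Ei Ej eqxx.
  by have := @no_return j i (ltac:(lia)); rewrite Ei Ej eqxx.
rewrite muln1.
have avj : avoids f B (take j bs ++ ls).
  apply: (avoids_part av (Q := drop j bs)).
  by apply/permP => r; rewrite -{3}(cat_take_drop j bs) !count_cat; lia.
have szj : size (take j bs) = j by rewrite size_takel //; lia.
apply: leq_trans (leq_add (count_psum_le (miss gamma) avj) (leqnn _)).
have in_coset t : (t <= size ls)%N -> (j != 1%N) || (0 < t)%N ->
    psum f (take j bs ++ ls) (j + t) \in miss gamma.
  move=> te tj; rewrite inE (psum_notin avj) ?size_cat ?szj; last by lia.
  have -> : psum f (take j bs ++ ls) (j + t) = psum f bs j + psum f ls t.
    by rewrite -{2}szj psum_cat.
  by rewrite raddfD /= pi_psum_ls addr0 Ej eqxx.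
rewrite size_cat szj iotaD count_cat.
have -> : count (fun i => psum f (take j bs ++ ls) i \in miss gamma)
     (iota (1 + j) (size ls)) = size ls.
  rewrite -[RHS](size_iota (1 + j)) -(count_predT (iota (1 + j) _)).
  apply: eq_in_count => i; rewrite mem_iota => Hi.
  have -> : i = (j + (i - j))%N by lia.
  by rewrite in_coset //; lia.
have [E1|j1] := eqVneq j 1%N; first by rewrite -Ej E1 eqxx; lia.
suff : (0 < count (fun i => psum f (take j bs ++ ls) i \in miss gamma) (iota 1 j))%N.
  by lia.
rewrite -has_count; apply/hasP; exists j; first by rewrite mem_iota; lia.
by rewrite -{2}[j]addn0 in_coset // j1.
Qed.

(** With g gaps, g + 1 kernel terms and n other terms the count is at least
    g + (g + 2) n - 1, and (n - 1) g >= 0. *)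
Lemma many_kernel_terms_le : (0 < size bs)%N ->
  (2 * (size bs + size ls) <= #|~: B| + 3)%N.
Proof.
have arith (m S n e : nat) :
  e = m.+1 -> (e.+1 * n <= S + 1 -> 0 < n -> 2 * (n + e) <= m + S + 3)%N.
  by move=> ->; nia.
move=> b0; rewrite -sum_miss (bigD1 (0 : G)) //=.
have H0 : hits 0%R = 0%N.
  apply/eqP; rewrite -leqn0 leqNgt; apply/negP => /hits0_kernel_terms_le.
  by rewrite lsE; lia.
have : ((size ls).+1 * size bs <= \sum_(g : G | g != 0%R) #|miss g| + 1)%N.
  rewrite -sum_hits (bigD1 (0 : G)) //= H0 add0n big_distrr /=.
  apply: (@leq_trans (\sum_(g : G | g != 0%R) (#|miss g| + (g == pi (psum f bs 1)))))%N.
    by apply: leq_sum => g _; exact: kernel_terms_hits_le.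
  rewrite big_split leq_add2l /= (bigID (fun g => g == pi (psum f bs 1))) /=.
  rewrite [X in (_ + X)%N]big1 ?addn0; last by move=> g /andP[_ /negbTE ->].
  rewrite big_andbC.
  have [E|E] := eqVneq (pi (psum f bs 1)) 0.
    by rewrite big_pred0 // => g; rewrite E; case: eqP.
  rewrite (big_pred1 (pi (psum f bs 1))) ?eqxx // => g /=.
  by case: eqP => // ->; rewrite E.
move=> H; exact: arith lsE H b0.
Qed.

End ManyKernelTerms.

End Cosets.

(** * Counting in the group of residue vectors *)

Section Grid.

Variables a d : nat.
Local Notation alpha := a.+1.
Local Notation grid := 'rV['I_a.+1]_d.

(** For the residue of a generator this is alpha minus the coordinate that has
    been dropped. *)
Definition height (h : grid) : nat := (\sum_k (h ord0 k : nat))%N.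

Definition set_at (k0 : 'I_d) (h : grid) (x : 'I_alpha) : grid :=
  \row_k (if k == k0 then x else h ord0 k).

Definition zero_at (k0 : 'I_d) (h : grid) : grid := set_at k0 h 0.

Lemma zero_at_is_zmod_morphism k0 : zmod_morphism (zero_at k0).
Proof.
by move=> x y; apply/rowP => k; rewrite !mxE; case: eqP => //; rewrite subr0.
Qed.
HB.instance Definition _ k0 :=
  GRing.isZmodMorphism.Build grid grid (zero_at k0) (zero_at_is_zmod_morphism k0).

Lemma set_at_zero k0 h x : zero_at k0 (set_at k0 h x) = zero_at k0 h.
Proof. by apply/rowP => k; rewrite !mxE; case: eqP. Qed.

Lemma set_atK k0 h : set_at k0 (zero_at k0 h) (h ord0 k0) = h.
Proof. by apply/rowP => k; rewrite !mxE; case: eqP => // ->. Qed.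

Lemma set_at_inj k0 h : injective (set_at k0 h).
Proof. by move=> x y /rowP/(_ k0); rewrite !mxE eqxx. Qed.

Lemma zero_at_id k0 h : (zero_at k0 h == h) = (h ord0 k0 == 0).
Proof.
apply/eqP/eqP => [<-|E]; first by rewrite mxE eqxx.
by apply/rowP => k; rewrite mxE; case: eqP => // ->; rewrite E.
Qed.

Lemma height_set_at k0 h x : height (set_at k0 h x) = (height (zero_at k0 h) + x)%N.
Proof.
rewrite /height (bigD1 k0) //= [in RHS](bigD1 k0) //= !mxE eqxx add0n addnC.
congr (_ + _)%N; apply: eq_bigr => k /negbTE kk; by rewrite !mxE kk.
Qed.

Lemma height_eq0 h : (height h == 0%N) = (h == 0).
Proof.
rewrite sum_nat_eq0; apply/forallP/eqP => [H|-> k]; last by rewrite mxE.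
by apply/rowP => k; rewrite mxE; apply/val_inj/eqP; exact: (H k).
Qed.

Section Sums.

Local Open Scope nat_scope.

Lemma sum_maxn (n m : nat) : n <= m ->
  2 * (\sum_(x < m) maxn n x) + m = m * m + n * n.+1.
Proof.
rewrite -(big_mkord xpredT).
elim: m => [|m IH] nm; first by rewrite big_geq //; lia.
have [E|nm'] := ltnP m n; last first.
  move: (IH nm'); rewrite big_nat_recr //=.
  by move: (\sum_(0 <= i < m) _) => S; rewrite (maxn_idPr nm'); nia.
have {nm E}-> : n = m.+1 by lia.
rewrite (eq_big_nat _ _ (F2 := fun=> m.+1)) => [|x Hx]; last by lia.
by rewrite sum_nat_const_nat; lia.
Qed.

(** A lower bound for the number of non-residues in a coset of height s that
    is visited n times: n by the visits, s - 1 by the height. *)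
Definition profile (n s : nat) : nat := maxn n (minn alpha s.-1).

Lemma line_profile_pos (n s : nat) : 4 * n < alpha -> 0 < s ->
  n * 2 * alpha <= \sum_(x < alpha) profile n (s + x).
Proof.
move=> na s0; apply: (@leq_trans (\sum_(x < alpha) maxn n x)).
  by have := @sum_maxn n alpha (ltac:(lia)); nia.
apply: leq_sum => x _; have := ltn_ord x; rewrite /profile; lia.
Qed.

(** The line through the origin is the worst one: the sum may fall short of
    2 n per coset, but by at most 3 in total.  For alpha = 4 n + 1 this is
    (n - 2)(n - 3) >= 0. *)
Lemma line_profile0 (n : nat) : 4 * n < alpha ->
  n * 2 * alpha <= \sum_(x < alpha) profile n x + 3.
Proof.
move=> na; rewrite big_ord_recl.
rewrite (eq_bigr (fun x : 'I_a => maxn n x)) => [|x _]; last first.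
  by have := ltn_ord x; rewrite lift0 /profile; lia.
have -> : profile n (@ord0 a) = n by rewrite /profile /=; lia.
have := @sum_maxn n a (ltac:(lia)); move: (\sum_(x < a) _) => S HS.
(* (n - 2)(n - 3) >= 0 *)
have n23 : 5 * n <= n * n + 6.
  by have [|] := leqP n 2; [case: n {na HS} => [|[|[|]]] | nia].
have [an|an] := eqVneq a (4 * n); first by rewrite an in HS *; nia.
have : a * (4 * n).+1 <= a * a by rewrite leq_mul2l; lia.
nia.
Qed.

Lemma sum_lines (p k0 : 'I_d) (F : grid -> nat) : k0 != p ->
  \sum_(h : grid | h ord0 p == 0%R) F h =
  \sum_(h : grid | (h ord0 p == 0%R) && (h ord0 k0 == 0%R))
     \sum_(x < alpha) F (set_at k0 h x).
Proof.
move=> kp; rewrite (partition_big (zero_at k0)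
  (fun h : grid => (h ord0 p == 0%R) && (h ord0 k0 == 0%R))) /=; last first.
  by move=> h hp; rewrite !mxE eqxx andbT; case: ifP.
apply: eq_bigr => h /andP[hp hk].
rewrite (reindex_onto (set_at k0 h) (fun h' : grid => h' ord0 k0)) /=.
  apply: eq_bigl => x; rewrite !mxE eqxx eqxx andbT set_at_zero.
  have -> : (p == k0) = false by rewrite eq_sym (negbTE kp).
  by rewrite hp zero_at_id hk.
move=> h' /andP[_ /eqP <-]; rewrite -[RHS](set_atK k0).
by apply/rowP => k; rewrite !mxE; case: eqP.
Qed.

(** Summation over the lines in the direction k0: only the line through the
    origin can have a deficit. *)
Lemma sum_profile (p k0 : 'I_d) (n : nat) : k0 != p -> 4 * n < alpha ->
  \sum_(h : grid | h ord0 p == 0%R) n * 2 <=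
  \sum_(h : grid | h ord0 p == 0%R) profile n (height h) + 3.
Proof.
move=> kp na; rewrite !(sum_lines _ kp).
rewrite (bigD1 (0%R : grid)) /=; last by rewrite !mxE eqxx.
rewrite [in X in _ <= X](bigD1 (0%R : grid)) /=; last by rewrite !mxE eqxx.
rewrite addnAC leq_add //.
  rewrite sum_nat_const card_ord mulnC.
  apply: leq_trans (line_profile0 na) _; rewrite leq_add2r leq_sum // => x _.
  have z0 : zero_at k0 (0%R : grid) = 0%R by apply/eqP; rewrite zero_at_id mxE.
  by rewrite height_set_at z0 (eqP (_ : height _ == 0)) ?height_eq0.
apply: leq_sum => h /andP[/andP[hp hk] h0].
rewrite sum_nat_const card_ord mulnC.
apply: leq_trans (line_profile_pos na (_ : 0 < height h)) _.
  by rewrite lt0n height_eq0.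
apply: leq_sum => x _; rewrite height_set_at.
by rewrite (eqP (_ : zero_at k0 h == h)) ?zero_at_id.
Qed.

End Sums.

Section Count.

Variables (p : 'I_d) (B : {set grid}).
Hypothesis B_height : forall h, h \in B -> (height h <= alpha)%N.

(** Putting a value x > alpha - height g into coordinate p makes the height
    exceed alpha. *)
Lemma miss_ge_height (g : grid) : g ord0 p = 0 ->
  (minn alpha (height g).-1 <= #|miss B (zero_at p) g|)%N.
Proof.
move=> gp; have [m1 m2] := (geq_minl alpha (height g).-1, geq_minr alpha (height g).-1).
move: (minn _ _) m1 m2 => m m1 m2; pose h (i : 'I_m) := set_at p g (inord (a - i)).
have hv (i : 'I_m) : (inord (a - i) : 'I_alpha) = (a - i)%N :> nat.
  by rewrite inordK //; lia.
have h_inj : injective h.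
  move=> i j /set_at_inj/(congr1 val); rewrite /= !hv => E; apply: val_inj => /=.
  have := ltn_ord i; have := ltn_ord j; lia.
rewrite -[leqLHS]card_ord -(card_imset _ h_inj) subset_leq_card //.
apply/subsetP => x /imsetP[i _ ->]; rewrite inE /= /h set_at_zero.
rewrite zero_at_id gp eqxx /=; apply/negP => /B_height.
have E : zero_at p g = g by apply/eqP; rewrite zero_at_id gp.
have := ltn_ord i; rewrite /h height_set_at hv E; lia.
Qed.

Variables (T : eqType) (f : T -> grid) (bs ls : seq T).
Hypothesis bsP : forall x, x \in bs -> zero_at p (f x) != 0.
Hypothesis lsP : forall x, x \in ls -> zero_at p (f x) = 0.
Hypothesis av : avoids f B (bs ++ ls).

Local Notation miss := (miss B (zero_at p)).
Local Notation hits := (hits f (zero_at p) bs).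

Lemma hits_off (g : grid) : g ord0 p != 0 -> hits g = 0%N.
Proof.
move=> gp; apply/eqP; rewrite eqn0Ngt -has_count -all_predC; apply/allP => j _ /=.
by apply: contraNneq gp => <-; rewrite mxE eqxx.
Qed.

Lemma sum_hits_on : (\sum_(g : grid | g ord0 p == 0%R) hits g = size bs)%N.
Proof.
rewrite -(sum_hits f (zero_at p) bs) [RHS](bigID (fun g : grid => g ord0 p == 0)).
by rewrite /= [X in (_ + X)%N]big1 ?addn0 // => g /hits_off.
Qed.

Lemma sum_miss_on : (\sum_(g : grid | g ord0 p == 0%R) #|miss g| <= #|~: B|)%N.
Proof.
rewrite -(sum_miss B (zero_at p)) [leqRHS](bigID (fun g : grid => g ord0 p == 0)).
exact: leq_addr.
Qed.

Lemma sum_pred1_le (h : grid) (P : pred grid) : (\sum_(g | P g) (g == h) <= 1)%N.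
Proof.
rewrite (bigID (pred1 h)) /= [X in (_ + X)%N]big1 ?addn0; last first.
  by move=> g /andP[_ /negbTE ->].
rewrite big_andbC; have [Ph|Ph] := boolP (P h).
  by rewrite (big_pred1 h) ?eqxx // => g /=; case: eqP => // ->.
by rewrite big_pred0 // => g; case: eqP => // ->; rewrite (negbTE Ph).
Qed.

(** In the comparison coset by coset, the one of the first term loses one and
    the kernel itself gains one, so that only the deficit 3 of sum_profile
    remains. *)
Lemma few_kernel_terms_le (k0 : 'I_d) : k0 != p -> (4 * #|miss 0%R|.+1 < alpha)%N ->
  (size ls <= #|miss 0%R|)%N ->
  (2 * (size bs + size ls) <= #|~: B| + 3)%N.
Proof.
move=> kp ga el; set n := #|miss 0%R|.+1 in ga.
have main (g : grid) : g ord0 p == 0 ->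
   (hits g * 2 + profile n (height g) + (g == 0%R) * (2 * size ls + 1)
    <= #|miss g| + n * 2 + (g == zero_at p (psum f bs 1)))%N.
  move=> /eqP gp; have [->|g0] := eqVneq g 0.
    have -> : height (0 : grid) = 0%N by apply/eqP; rewrite height_eq0.
    have arith h e m z : (e <= m -> (0 < h -> h + e <= m) ->
      h * 2 + profile m.+1 0 + 1 * (2 * e + 1) <= m + m.+1 * 2 + z)%N.
      by rewrite /profile /=; lia.
    exact: arith el (hits0_kernel_terms_le bsP lsP av).
  have arith h m z s n' : (h <= n' -> h <= m + z -> minn alpha s.-1 <= m ->
    h * 2 + profile n' s + 0 * (2 * size ls + 1) <= m + n' * 2 + z)%N.
    by rewrite /profile; lia.
  exact: arith (hits_le bsP av g) (miss_ge_hits _ av g) (miss_ge_height gp).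
have := leq_sum (index_enum _) main; move: (n) ga => {main} n' ga.
rewrite !big_split /= -big_distrl /=.
have -> : (\sum_(i : grid | i ord0 p == 0%R) (i == 0%R) * (2 * size ls + 1)
  = 2 * size ls + 1)%N.
  rewrite (bigD1 (0 : grid)) /= ?mxE // eqxx mul1n big1 ?addn0 //.
  by move=> g /andP[_ /negbTE ->].
rewrite sum_hits_on => H.
have arith h ph e m k z c : (h * 2 + ph + (2 * e + 1) <= m + k + z -> z <= 1 ->
  k <= ph + 3 -> m <= c -> 2 * (h + e) <= c + 3)%N by lia.
exact: arith H (sum_pred1_le _ _) (sum_profile kp ga) sum_miss_on.
Qed.

Lemma sum_mem (P : pred grid) (D : {set grid}) :
  (\sum_(g | P g) (g \in D) = #|[pred g | P g && (g \in D)]|)%N.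
Proof.
by rewrite -sum1_card big_mkcondr /=; apply: eq_bigr => g _; case: (g \in D).
Qed.

(** Cosets of height 4, which miss at least three elements if alpha >= 3. *)
Definition two_peaks (k0 k : 'I_d) : grid := set_at k (set_at k0 0 (inord 2)) (inord 2).

Definition peaks : {set grid} := [set set_at k (0 : grid) (inord 1) | k in predC1 p].

Lemma height1_peak (g : grid) : (0 < a)%N ->
  g ord0 p = 0 -> height g = 1%N -> g \in peaks.
Proof.
move=> a0 gp g1; have [k gk] : exists k, g ord0 k != 0.
  apply/existsP; rewrite -negb_forall; apply/forallP => g0; have := g1.
  suff -> : g = 0 by move/eqP; rewrite (eqP (_ : height 0 == 0%N)) ?height_eq0.
  by apply/rowP => k; rewrite mxE; apply/eqP.
have := height_set_at k g (g ord0 k).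
have -> : set_at k g (g ord0 k) = g.
  by apply/rowP => i; rewrite mxE; case: eqP => // ->.
have gk' : (0 < g ord0 k)%N by rewrite lt0n; apply: contra gk => /eqP E; apply/eqP/val_inj.
rewrite g1 => E; have E1 : g ord0 k = 1%N :> nat by lia.
have E0 : zero_at k g = 0 by apply/eqP; rewrite -height_eq0; apply/eqP; lia.
apply/imsetP; exists k.
  by rewrite inE; apply: contraNneq gk => ->; rewrite gp.
rewrite -[LHS](set_atK k) E0; congr set_at; apply: val_inj.
by rewrite /= inordK.
Qed.

(** Without gaps every coset is visited at most once, and a visited coset
    should miss two elements.  It may fail to do so by one if its height is 1;
    these cosets are compensated by those of two_peaks, which miss three.  The
    hypothesis on height 2 leaves only the first two steps as further
    exceptions. *)
Lemma no_gap_count_le (k0 : 'I_d) : k0 != p -> (1 < a)%N -> #|miss 0%R| = 0%N ->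
  (forall j, (2 < j <= size bs)%N -> height (zero_at p (psum f bs j)) = 2%N ->
     (1 < #|miss (zero_at p (psum f bs j))|)%N) ->
  (2 * size bs <= #|~: B| + 3)%N.
Proof.
move=> kp a1 g0 HR.
pose D := [set two_peaks k0 k | k in [pred k | (k != p) && (k != k0)]].
have i2 : (inord 2 : 'I_alpha) = 2%N :> nat by rewrite inordK.
have D_p g : g \in D -> g ord0 p == 0.
  case/imsetP => k /andP[kp' kk] ->; rewrite !mxE.
  have -> : (p == k) = false by rewrite eq_sym (negbTE kp').
  by have -> : (p == k0) = false by rewrite eq_sym (negbTE kp).
have D_height g : g \in D -> height g = 4%N.
  case/imsetP => k /andP[kp' kk] ->; rewrite /two_peaks height_set_at.
  have -> : zero_at k (set_at k0 (0 : grid) (inord 2)) = set_at k0 0 (inord 2).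
    by apply/eqP; rewrite zero_at_id !mxE (negbTE kk).
  rewrite height_set_at; have -> : zero_at k0 (0 : grid) = 0 by exact: raddf0.
  by rewrite (eqP (_ : height 0 == 0%N)) ?height_eq0 // i2.
have cD : #|D| = #|[pred k : 'I_d | (k != p) && (k != k0)]|.
  apply: card_in_imset => k l /andP[_ kk] /andP[_ lk] /rowP/(_ k).
  rewrite !mxE eqxx (negbTE kk); case: eqP => // _ /(congr1 val) /=.
  by rewrite i2.
have hits01 g : (hits g <= 1)%N by have := hits_le bsP av g; rewrite g0.
have main (g : grid) : g ord0 p == 0 ->
  (hits g * 2 + (g \in D) <= #|miss g| + (g \in peaks) +
     (g == zero_at p (psum f bs 1)) + (g == zero_at p (psum f bs 2)))%N.
  move=> /eqP gp; have m1 := miss_ge_height gp.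
  have m2 : (hits g <= #|miss g| + (g == zero_at p (psum f bs 1)))%N.
    exact: (miss_ge_hits (zero_at p) av g).
  have [h0|] := posnP (hits g).
    rewrite h0; have [/D_height gD|] := boolP (g \in D); last by [].
    by move: m1; rewrite gD; lia.
  move=> h1; have {h1}h1 : hits g = 1%N by have := hits01 g; lia.
  have gn0 : height g != 0%N.
    rewrite height_eq0; apply/eqP => E; have := hits0_kernel_terms_le bsP lsP av.
    by rewrite -E h1 E g0 => /(_ isT).
  have [/D_height gD|_] := boolP (g \in D); first by move: m1; rewrite h1 gD; lia.
  have [g3|g2] := ltnP 2 (height g); first by move: m1; rewrite h1; lia.
  have [E2|n2] := eqVneq (height g) 2%N; last first.
    rewrite (height1_peak _ gp) ?h1; [|by lia|by lia].
    by move: m2; rewrite h1; lia.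
  have : (0 < hits g)%N by rewrite h1.
  rewrite -has_count => /hasP[j]; rewrite mem_iota => Hj /eqP Ej.
  have [j3|j3] := ltnP 2 j.
    have := HR j (ltac:(lia)); rewrite [zero_at _ _]Ej E2 => /(_ erefl) m3.
    by rewrite h1; lia.
  have : (g == zero_at p (psum f bs 1)) || (g == zero_at p (psum f bs 2)).
    have : (j == 1%N) || (j == 2%N) by lia.
    by case/orP => /eqP Ej'; rewrite -Ej Ej' eqxx ?orbT.
  by move: m1; rewrite h1 E2; lia.
have := leq_sum (index_enum _) main.
rewrite !big_split /= -big_distrl /= sum_hits_on !sum_mem => H.
have c1 : (#|[pred g : grid | (g ord0 p == 0%R) && (g \in peaks)]| <= d.-1)%N.
  apply: (@leq_trans #|peaks|); first by apply/subset_leq_card/subsetP => g /andP[].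
  by apply: leq_trans (leq_imset_card _ _) _; rewrite cardC1 card_ord.
have c2 : (#|[pred g : grid | (g ord0 p == 0%R) && (g \in D)]| = d.-2)%N.
  transitivity #|D|.
    by apply: eq_card => g; rewrite !inE; case: (boolP (g \in D)) => [/D_p ->|]; rewrite ?andbF.
  rewrite cD; transitivity #|~: [set p; k0]|.
    by apply: eq_card => k; rewrite !inE negb_or.
  by have := cardsC [set p; k0]; rewrite cards2 eq_sym kp card_ord; lia.
have arith h dd m pp z1 z2 c n : (h * 2 + dd <= m + pp + z1 + z2 -> z1 <= 1 ->
   z2 <= 1 -> m <= c -> pp <= n.-1 -> dd = n.-2 -> 1 < n -> 2 * h <= c + 3)%N by lia.
apply: arith H (sum_pred1_le _ _) (sum_pred1_le _ _) sum_miss_on c1 c2 _.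
have := max_card (mem [set p; k0]); rewrite cards2 eq_sym kp card_ord; exact.
Qed.

Lemma binary_double (x : grid) : a = 1%N -> x + x = 0.
Proof.
move=> a1; apply/rowP => k; rewrite !mxE; apply: val_inj => /=.
move: (ltn_ord (x ord0 k)); move: (nat_of_ord _) => y; rewrite a1.
by case: y => [|[|]].
Qed.

(** For alpha = 2 the 2 ^ (size bs) subset sums modulo the kernel are distinct:
    two equal ones would add up, in characteristic 2, to the sum over the
    symmetric difference, and a nonempty subsum in the kernel is a gap. *)
Lemma binary_full_edge_size : a = 1%N -> #|miss 0%R| = 0%N -> (size bs < d)%N.
Proof.
move=> a1 g0; have av_bs : avoids f B bs := avoids_part av (perm_refl _).
pose v i := zero_at p (f (tnth (in_tuple bs) i)).
pose F (S : {set 'I_(size bs)}) := \sum_(i in S) v i.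
have F_neq0 S : S != set0 -> F S != 0.
  move=> S0; pose P := [seq tnth (in_tuple bs) i | i <- enum S].
  pose Q := [seq tnth (in_tuple bs) i | i <- enum (~: S)].
  have PQ : perm_eq (P ++ Q) bs.
    rewrite -map_cat -[X in perm_eq _ X](map_tnth_enum (in_tuple bs)).
    apply: perm_map; apply: uniq_perm; rewrite ?enum_uniq //.
      rewrite cat_uniq !enum_uniq andbT /=; apply/hasPn => i.
      by rewrite !mem_enum inE.
    by move=> i; rewrite mem_cat !mem_enum !inE orbN.
  have szP : size P = #|S| by rewrite size_map cardE.
  have FE : F S = zero_at p (\sum_(x <- P) f x).
    by rewrite raddf_sum big_map /F -big_enum.
  have P0 : P != [::] by rewrite -size_eq0 szP cards_eq0.
  have [_ PB] := av_bs P Q PQ P0.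
  apply/negP => /eqP F0; have [P1|P1] := leqP (size P) 1.
    have /cards1P[i Ei] : #|S| == 1%N by rewrite -szP eqn_leq P1 lt0n size_eq0.
    have/eqP[] := bsP (mem_tnth i (in_tuple bs)).
    by rewrite -F0 /F Ei big_set1.
  move/eqP: g0; rewrite cards_eq0 => /eqP/setP/(_ (\sum_(x <- P) f x)).
  by rewrite !inE PB //= -FE F0 eqxx.
have F_inj : injective F.
  move=> S1 S2 E; pose D := [set i | (i \in S1) (+) (i \in S2)].
  suff FD : F D == 0.
    have /setP D0 : D = set0 by apply/eqP; apply: contraTT FD; exact: F_neq0.
    apply/setP => i; move: (D0 i); rewrite !inE.
    by case: (i \in S1); case: (i \in S2).
  suff -> : F D = F S1 + F S2 by rewrite E binary_double.
  rewrite /F [LHS]big_mkcond [X in X + _]big_mkcond [X in _ + X]big_mkcond.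
  rewrite -big_split; apply: eq_bigr => i _; rewrite inE /=.
  by case: (i \in S1); case: (i \in S2) => /=; rewrite ?addr0 ?add0r ?binary_double.
(* the free coordinate p turns the injection into one with values in the
   whole group, whose order is known *)
pose H (Sx : {set 'I_(size bs)} * 'I_alpha) := set_at p (F Sx.1) Sx.2.
have H_inj : injective H.
  move=> [S x] [S' x'] E; have Fp S0 : zero_at p (F S0) = F S0.
    apply/eqP; rewrite zero_at_id summxE big1 // => i _; by rewrite mxE eqxx.
  have ES : S = S'.
    apply: F_inj; rewrite -(Fp S) -(Fp S') -(set_at_zero p (F S) x).
    by rewrite -(set_at_zero p (F S') x'); congr zero_at.
  by move: E; rewrite /H /= ES => /set_at_inj ->.
have := max_card (mem (codom H)); rewrite card_codom // card_prod -cardsT -powersetT card_powerset cardsT.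
rewrite card_ord card_mx !card_ord mul1n a1 -expnSr leq_exp2l //.
Qed.
End Count.

End Grid.

(** * Irreducible sequences of generators *)

Section Reducible.

Variables (c n alpha : nat) (A : 'I_c -> 'X_{1..n}).

(** The monomial x^s is then the leading term of x^s - x^f y^w, an element of
    the ideal: only the second term contains y's, the smallest variables. *)
Definition reducible (s : seq 'I_c) : Prop :=
  exists f (w : 'X_{1..n}), w != 0%MM /\
    (\sum_(i <- s) A i = \sum_(i <- f) A i + w *+ alpha)%MM.

Lemma reducible_part (s P Q : seq 'I_c) :
  perm_eq (P ++ Q) s -> reducible P -> reducible s.
Proof.
move=> PQ [f [w [w0 E]]]; exists (f ++ Q), w; split=> //.
by rewrite -(perm_big _ PQ) /= !big_cat /= E -!addmA [(w *+ _ + _)%MM]addmC.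
Qed.

Hypothesis A_deg : forall i, mdeg (A i) = alpha.

Lemma mdeg_sumA (s : seq 'I_c) : mdeg (\sum_(i <- s) A i)%MM = (alpha * size s)%N.
Proof.
rewrite mdeg_sum (eq_bigr (fun=> alpha)) //.
by rewrite big_const_seq count_predT iter_addn_0 mulnC.
Qed.

End Reducible.

Section Residues.

Variables (c a d : nat) (A : 'I_c -> 'X_{1..d.+1}) (q : 'I_d.+1).
Local Notation alpha := a.+1.
Local Notation grid := 'rV['I_a.+1]_d.

Hypothesis a_gt0 : (0 < a)%N.
Hypothesis A_deg : forall i, mdeg (A i) = alpha.
Hypothesis A_inj : injective A.
Hypothesis A_nvertex : forall i k, A i != (U_(k) *+ alpha)%MM.

Lemma A_lt i k : (A i k < alpha)%N.
Proof.
rewrite ltnNge; apply/negP => Ak; have/eqP[] := A_nvertex i k.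
have := A_deg i; rewrite mdegE (bigD1 k) //= => E.
have E0 : (\sum_(j < d.+1 | j != k) A i j)%N = 0%N by apply/eqP; rewrite -leqn0 -(leq_add2l (A i k)) addn0 E.
apply/mnmP => j; rewrite mulmnE mnm1E; have [<-|kj] := eqVneq k j; first by rewrite mul1n -[RHS]E E0 addn0.
rewrite mul0n; apply/eqP; move/eqP: E0; rewrite sum_nat_eq0 => /forallP/(_ j).
by rewrite eq_sym kj.
Qed.

(** The coordinate q carries no information modulo alpha, since the degree
    of every point of S is divisible by alpha. *)
Definition res (v : 'X_{1..d.+1}) : grid := \row_k inZp (v (lift q k)).

Lemma res_val v k : res v ord0 k = (v (lift q k) %% alpha)%N :> nat.
Proof. by rewrite mxE. Qed.

Lemma res0 : res 0%MM = 0.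
Proof. by apply/rowP => k; apply: val_inj; rewrite /= !mxE /= mnm0E mod0n. Qed.

Lemma resD v w : res (v + w)%MM = res v + res w.
Proof.
by apply/rowP => k; apply: val_inj; rewrite !mxE /= mnmDE modnDm.
Qed.

Lemma res_sum (s : seq 'I_c) :
  res (\sum_(i <- s) A i)%MM = \sum_(i <- s) res (A i).
Proof. exact: (big_morph res resD res0). Qed.

(** A vector with entries below alpha is the least one in its class, so any
    other vector of the class arises from it by adding vertices. *)
Lemma res_eq_lift (v b : 'X_{1..d.+1}) : res v = res b ->
  mdeg v = mdeg b %[mod alpha] -> (forall k, b k < alpha)%N ->
  exists w, v = (b + w *+ alpha)%MM.
Proof.
move=> vb Emod b_lt.
have E k : v k = b k %[mod alpha].
  have El j : v (lift q j) = b (lift q j) %[mod alpha].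
    by rewrite -!res_val vb.
  case: (unliftP q k) => [j ->|->]; first exact: El.
  move: Emod; rewrite !mdegE (bigD1 q) //= [X in _ = X %[mod _]](bigD1 q) //=.
  move=> H; have S : (\sum_(j < d.+1 | j != q) v j = \sum_(j < d.+1 | j != q) b j
     %[mod alpha])%N.
    elim/big_ind2: _ => // [x1 x2 y1 y2 H1 H2|j jq].
      by rewrite -modnDm H1 H2 modnDm.
    by case: (unliftP q j) jq => [i ->|->]; rewrite ?eqxx.
  move/eqP: H; rewrite -modnDmr S modnDmr eqn_modDr => /eqP; exact.
exists [multinom (v k %/ alpha)%N | k < d.+1]; apply/mnmP => k.
rewrite mnmDE mulmnE mnmE -{1}(modn_small (b_lt k)) -E.
by rewrite {1}(divn_eq (v k) alpha) addnC.
Qed.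

(** All vertices have residue 0. *)
Definition taken : {set grid} := 0 |: [set res (A i) | i : 'I_c].

Lemma res_A_val i k : res (A i) ord0 k = A i (lift q k) :> nat.
Proof. by rewrite res_val modn_small // A_lt. Qed.

Lemma height_res_A i : (A i q + height (res (A i)) = alpha)%N.
Proof.
rewrite -(A_deg i) mdegE (bigD1_ord q) //= /height; congr (_ + _)%N.
by apply: eq_bigr => k _; rewrite res_A_val.
Qed.

Lemma A_split i : A i q = (alpha - height (res (A i)))%N.
Proof. by rewrite -(height_res_A i) addnK. Qed.

Lemma height_res_le i : (height (res (A i)) <= alpha)%N.
Proof. by rewrite -(height_res_A i) leq_addl. Qed.

Lemma res_A_inj : injective (fun i => res (A i)).
Proof.
move=> i j E; apply: A_inj; apply/mnmP => k; case: (unliftP q k) => [l ->|->].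
  by rewrite -!res_A_val E.
by rewrite !A_split E.
Qed.

Lemma res_A_neq0 i : res (A i) != 0.
Proof.
apply/eqP => E; have := A_lt i q; rewrite A_split E.
by rewrite (eqP (_ : height 0 == 0%N)) ?height_eq0 // subn0 ltnn.
Qed.

Lemma card_taken : #|taken| = c.+1.
Proof.
rewrite cardsU1 card_imset ?card_ord; last exact: res_A_inj.
suff -> : (0 : grid) \in [set res (A i) | i : 'I_c] = false by [].
by apply/negP => /imsetP[i _ /esym/eqP]; apply/negP/res_A_neq0.
Qed.

Lemma card_untaken : (#|~: taken| + c.+1 = alpha ^ d)%N.
Proof. by rewrite -card_taken addnC cardsC card_mx card_ord mul1n. Qed.

Lemma taken_height h : h \in taken -> (height h <= alpha)%N.
Proof.
rewrite !inE => /orP[/eqP ->|/imsetP[i _ ->]]; last exact: height_res_le.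
by rewrite (eqP (_ : height 0 == 0%N)) ?height_eq0.
Qed.

Lemma taken_neq0 h : h \in taken -> h != 0 -> exists i, h = res (A i).
Proof. by rewrite !inE => /orP[->//|/imsetP[i _ ->] _]; exists i. Qed.

(** Shorter sequence, same residue, small entries: the difference of the two
    sums is a nonzero sum of vertices. *)
Lemma reducible_res (P f : seq 'I_c) : (size f < size P)%N ->
  \sum_(i <- P) res (A i) = \sum_(i <- f) res (A i) ->
  (forall k, (\sum_(i <- f) A i)%MM k < alpha)%N -> reducible alpha A P.
Proof.
move=> fP E f_lt; have [||w Ew] := @res_eq_lift (\sum_(i <- P) A i)%MM (\sum_(i <- f) A i)%MM _ _ f_lt.
- by rewrite !res_sum.
- by rewrite !(mdeg_sumA A_deg) !modnMr.
exists f, w; split => //; apply: contraTneq fP => w0.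
have := congr1 mdeg Ew; rewrite mdegD !(mdeg_sumA A_deg) w0 mdegMn mdeg0 mul0n addn0.
by move/eqP; rewrite eqn_pmul2l // => /eqP ->; rewrite ltnn.
Qed.

Lemma irreducible_avoids (s : seq 'I_c) : ~ reducible alpha A s ->
  avoids (fun i => res (A i)) taken s.
Proof.
move=> irr P Q PQ P0.
have irrP : ~ reducible alpha A P by move=> /(reducible_part PQ).
have P0' : (0 < size P)%N by rewrite lt0n size_eq0.
have n0 : \sum_(x <- P) res (A x) != 0.
  apply/eqP => E; apply: irrP; apply: (@reducible_res P [::]) => //.
    by rewrite big_nil.
  by move=> k; rewrite big_nil mnm0E.
split=> // P1; apply/negP => /taken_neq0/(_ n0)[i E]; apply: irrP.
apply: (@reducible_res P [:: i]) => //; first by rewrite big_seq1.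
by move=> k; rewrite big_seq1 A_lt.
Qed.

Lemma irreducible_size (s : seq 'I_c) : ~ reducible alpha A s ->
  (size s + c <= alpha ^ d)%N.
Proof. 
by move=> /irreducible_avoids/avoids_size H; rewrite -card_untaken addnS -addSn leq_add2r.
Qed.

Section Edge.

Variables (p k0 : 'I_d).
Hypothesis k0p : k0 != p.

(** These elements correspond to the lattice points of the edge that are not
    in A. *)
Definition gaps : nat := #|miss taken (zero_at p) (0 : grid)|.

Hypothesis gapsP : gaps = 0%N \/ (4 * gaps.+1 < alpha)%N.

Let on_edge (i : 'I_c) : bool := zero_at p (res (A i)) == 0.

(** In a coset of height 2 the element with p-coordinate alpha - 1 is never a
    residue.  If it is the only one, it is the sum of the residues of the edge
    point with p-coordinate 1 and of a generator with p-coordinate alpha - 2;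
    the sum of these two points has entries below alpha, so that any longer
    sequence with this residue is reducible. *)
Lemma full_edge_two_sums (P : seq 'I_c) : (1 < a)%N -> gaps = 0%N ->
  (2 < size P)%N -> height (zero_at p (\sum_(i <- P) res (A i))) = 2%N ->
  (#|miss taken (zero_at p) (zero_at p (\sum_(i <- P) res (A i)))| <= 1)%N ->
  \sum_(i <- P) res (A i) \notin taken ->
  reducible alpha A P.
Proof.
move=> a1 g0 szP h2 m1 zP; set z := \sum_(i <- P) res (A i) in h2 m1 zP *.
pose e x := set_at p z (x : 'I_alpha).
have ze x : zero_at p (e x) = zero_at p z by rewrite set_at_zero.
have he x : height (e x) = (2 + x)%N by rewrite height_set_at h2.
have in_miss x : e x \notin taken -> z = e x.
  move=> ex; apply: (card_le1_eqP m1); rewrite inE /= ?eqxx ?zP //.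
  by rewrite ze eqxx ex.
have [ia ia1] : (inord a : 'I_alpha) = a :> nat /\ (inord a.-1 : 'I_alpha) = a.-1 :> nat.
  by rewrite !inordK //; lia.
have Ez : z = e (inord a).
  by apply: in_miss; apply/negP => /taken_height; rewrite he ia; lia.
have e1 : e (inord a.-1) \in taken.
  apply: contraT => /in_miss; rewrite {1}Ez => /set_at_inj/(congr1 val) /=.
  by rewrite ia ia1; lia.
have e2 : set_at p (0 : grid) (inord 1) \in taken.
  apply: contraT => h; move/eqP: g0; rewrite cards_eq0 => /eqP/setP.
  move=> /(_ (set_at p (0 : grid) (inord 1))); rewrite in_set0 in_set h andbT /= set_at_zero.
  by rewrite zero_at_id mxE eqxx.
have [|i1 E1] := taken_neq0 e1.
  by rewrite -height_eq0 he.
have [|i2 E2] := taken_neq0 e2.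
  rewrite -height_eq0 height_set_at inordK //; lia.
have hz : zero_at p (0 : grid) = 0 by exact: raddf0.
have h1 : height (set_at p (0 : grid) (inord 1)) = 1%N.
  by rewrite height_set_at hz (eqP (_ : height 0 == 0%N)) ?height_eq0 // inordK //; lia.
apply: (@reducible_res P [:: i1; i2]) => //.
  rewrite big_cons big_seq1 -E1 -E2 -/z {1}Ez.
  apply/rowP => k; rewrite !mxE; case: eqP => _; last by rewrite addr0.
  apply: val_inj; rewrite /= ia ia1 inordK; last by lia.
  by rewrite addn1 prednK // modn_small.
move=> k; rewrite big_cons big_seq1 mnmDE.
case: (unliftP q k) => [l ->|->]; last first.
  have := height_res_A i1; have := height_res_A i2.
  by rewrite -E1 -E2 h1 he ia1; lia.
rewrite -!res_A_val -E1 -E2 !mxE; case: eqP => _.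
  by rewrite ia1 inordK //; lia.
by rewrite addn0.
Qed.

(** For alpha = 2 the points that are not vertices are sums of two distinct
    unit vectors. *)
Lemma card_binary : a = 1%N -> (c <= 'C(d.+1, 2))%N.
Proof.
move=> a1; pose S i := [set k | A i k != 0%N].
have A01 i k : A i k = (k \in S i).
  by rewrite inE; have := A_lt i k; rewrite a1; case: (A i k) => [|[|]].
have S2 i : #|S i| = 2%N.
  have := A_deg i; rewrite a1 mdegE => <-; rewrite -[LHS]sum1_card [LHS]big_mkcond /=.
  by apply: eq_bigr => k _; rewrite A01; case: (k \in S i).
have S_inj : injective S.
  by move=> i j E; apply: A_inj; apply/mnmP => k; rewrite !A01 E.
rewrite -[d.+1]card_ord -card_draws -[leqLHS]card_ord -(card_imset _ S_inj).
by apply/subset_leq_card/subsetP => _ /imsetP[i _ ->]; rewrite inE S2.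
Qed.

Lemma binary_arith (m : nat) : (1 < m)%N -> (2 * m + 'C(m.+1, 2) <= 2 ^ m + 4)%N.
Proof.
elim: m => [//|[//|[//|[//|m]]] IH] _; rewrite binS bin1 expnS.
move: (IH isT) (@ltn_expl 2 m.+2 isT); rewrite [(2 ^ m.+3)%N]expnS.
by move: ('C(_, _)) (2 ^ _)%N => x y; lia.
Qed.

(** The terms on the edge are the kernel terms.  If they alone exceed the
    number of gaps, the count is direct; in the degenerate case of a sequence
    inside the edge, a coset of height alpha - 1 supplies what is missing. *)
Theorem irreducible_size_edge (s : seq 'I_c) : ~ reducible alpha A s ->
  (2 * size s + c <= alpha ^ d + 2)%N.
Proof.
move=> irr; pose bs := [seq i <- s | ~~ on_edge i]; pose ls := [seq i <- s | on_edge i].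
have bls : perm_eq (bs ++ ls) s.
  by rewrite perm_catC; apply/permPl; exact: perm_filterC.
have irr' : ~ reducible alpha A (bs ++ ls).
  by move=> R; apply: irr; apply: (reducible_part (Q := [::]) _ R); rewrite cats0.
have av := irreducible_avoids irr'.
have bsP x : x \in bs -> zero_at p (res (A x)) != 0.
  by rewrite mem_filter => /andP[].
have lsP x : x \in ls -> zero_at p (res (A x)) = 0.
  by rewrite mem_filter => /andP[/eqP].
suff : (2 * (size bs + size ls) <= #|~: taken| + 3)%N.
  have arith k u m : (2 * k <= u + 3 -> u + c.+1 = m -> 2 * k + c <= m + 2)%N by lia.
  by rewrite -size_cat (perm_size bls) => H; exact: arith H card_untaken.
have eg : (size ls <= gaps.+1)%N := kernel_terms_le lsP av.
have ga : (gaps <= a)%N by case: gapsP; lia.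
have [|e_max] := leqP (size ls) gaps; last first.
  have {e_max}e_max : size ls = gaps.+1 by lia.
  have [b0|] := posnP (size bs); last exact: many_kernel_terms_le bsP lsP av e_max.
  rewrite b0 e_max add0n.
  (* a coset of height alpha - 1, missing at least alpha - 2 elements *)
  pose g := set_at k0 (0 : grid) (inord a).
  have hz k : zero_at k (0 : grid) = 0 by exact: raddf0.
  have hg : height g = a.
    by rewrite height_set_at hz (eqP (_ : height 0 == 0%N)) ?height_eq0 // inordK.
  have gp : g ord0 p = 0 by rewrite !mxE eq_sym (negbTE k0p).
  have := miss_ge_height taken_height gp; rewrite hg => m1.
  have : (gaps + #|miss taken (zero_at p) g| <= #|~: taken|)%N.
    rewrite -(sum_miss taken (zero_at p)) (bigD1 (0 : grid)) //= leq_add2l.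
    by rewrite (bigD1 g) ?leq_addr //= -height_eq0 hg -lt0n.
  lia.
move=> e_le; case: gapsP => [g0|]; last first.
  by move=> ga'; exact: (few_kernel_terms_le taken_height bsP lsP av k0p ga' e_le).
have ls0 : size ls = 0%N by lia.
rewrite ls0 addn0; have [a1|a1] := ltnP 1 a.
  apply: (no_gap_count_le taken_height bsP lsP av k0p a1 g0) => j /andP[j2 jb] h2.
  rewrite ltnNge; apply/negP => m1; apply: irr'.
  have szj : size (take j bs) = j by rewrite size_takel.
  apply: (@reducible_part _ _ _ _ _ (take j bs) (drop j bs ++ ls)).
    by rewrite catA cat_take_drop.
  apply: full_edge_two_sums; rewrite ?szj //.
  by apply: (psum_notin (avoids_part av (perm_refl _))); rewrite jb andbT ltnW.
have {}a1 : a = 1%N by lia.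
have b_d := binary_full_edge_size bsP av a1 g0.
have d1 : (1 < d)%N.
  have := max_card (mem [set p; k0]); rewrite cards2 eq_sym k0p card_ord; exact.
have arith m u t cc : (t < m -> 2 * m + cc <= 2 ^ m + 4 -> c <= cc ->
  u + c.+1 = 2 ^ m -> 2 * t <= u + 3)%N by lia.
apply: arith b_d (binary_arith d1) (card_binary a1) _.
by rewrite card_untaken a1.
Qed.

End Edge.

End Residues.

(** * Irreducible sequences on a segment *)

Section TwoCoordinates.

Variables (c n a : nat) (A : 'I_c -> 'X_{1..n}).
Local Notation alpha := a.+1.

Hypothesis A_deg : forall i, mdeg (A i) = alpha.
Hypothesis A_inj : injective A.
Hypothesis A_nvertex : forall i k, A i != (U_(k) *+ alpha)%MM.

Local Open Scope nat_scope.

Lemma mdeg_two (p q : 'I_n) (v : 'X_{1..n}) : p != q ->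
  (forall k, k = p \/ k = q) -> mdeg v = v p + v q.
Proof.
move=> pq pqP; rewrite mdegE (bigD1 p) //= (bigD1 q) 1?eq_sym //=.
by rewrite big1 ?addn0 // => k /andP[/eqP kp /eqP kq]; case: (pqP k).
Qed.

Section OneSide.

Variables p q : 'I_n.
Hypothesis pq : p != q.
Hypothesis pqP : forall k, k = p \/ k = q.

Lemma A_two i : A i p + A i q = alpha.
Proof. by rewrite -(mdeg_two _ pq pqP). Qed.

Lemma A_p_bounds i : 0 < A i p < alpha.
Proof.
have H := A_two i; rewrite lt0n; apply/andP; split.
  apply/eqP => E; have/eqP[] := A_nvertex i q; apply/mnmP => k.
  rewrite mulmnE mnm1E; case: (pqP k) => ->; rewrite ?eqxx ?[q == p]eq_sym ?(negbTE pq) //.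
  by rewrite mul1n -H E.
rewrite ltnNge; apply/negP => E; have/eqP[] := A_nvertex i p; apply/mnmP => k.
rewrite mulmnE mnm1E; case: (pqP k) => ->; rewrite ?eqxx ?(negbTE pq) //; lia.
Qed.

Definition edge_gaps : {set 'I_alpha} :=
  [set x : 'I_alpha | (x != 0 :> nat) && [forall i, A i p != x :> nat]].

Lemma card_edge_gaps : #|edge_gaps| + c.+1 = alpha.
Proof.
pose f i : 'I_alpha := inord (A i p).
have fE i : f i = A i p :> nat.
  by rewrite inordK //; case/andP: (A_p_bounds i).
have f_inj : injective f.
  move=> i j /(congr1 val); rewrite /= !fE => E; apply: A_inj; apply/mnmP => k.
  by case: (pqP k) => -> //; have := A_two i; have := A_two j; lia.
have -> : edge_gaps = ~: (ord0 |: [set f i | i : 'I_c]).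
  apply/setP => x; rewrite !inE negb_or; congr andb.
  apply/forallP/negP => [H /imsetP[i _ E]|H i].
    by have := H i; rewrite E fE eqxx.
  apply: contra_notN H => /eqP E; apply/imsetP; exists i => //.
  by apply: val_inj; rewrite /= fE.
have -> : c.+1 = #|ord0 |: [set f i | i : 'I_c]|.
  rewrite cardsU1 card_imset // card_ord.
  suff -> : (ord0 : 'I_alpha) \in [set f i | i : 'I_c] = false by [].
  apply/negP => /imsetP[i _ /(congr1 val)]; rewrite /= fE => E.
  by have := A_p_bounds i; rewrite -E.
by rewrite addnC cardsC card_ord.
Qed.

(** The value 0 stands for the vertex of q. *)
Lemma not_gap (x : nat) (lt_x : x < alpha) : Ordinal lt_x \notin edge_gaps ->
  x = 0 \/ exists i, A i p = x.
Proof.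
rewrite inE negb_and negbK => /orP[/eqP|]; first by left.
by rewrite negb_forall => /existsP[i]; rewrite negbK => /eqP; right; exists i.
Qed.

(** Pigeonhole on the r + 1 pairs (x, r - x): each gap spoils at most two. *)
Lemma pair_avoiding_gaps (r : nat) : 2 * #|edge_gaps| <= r < alpha ->
  exists x y, [/\ x + y = r, x = 0 \/ exists i, A i p = x
                & y = 0 \/ exists i, A i p = y].
Proof.
move=> /andP[gr ra].
pose g1 (x : 'I_r.+1) : 'I_alpha := inord x.
pose g2 (x : 'I_r.+1) : 'I_alpha := inord (r - x).
have g1E x : g1 x = x :> nat by rewrite inordK //; have := ltn_ord x; lia.
have g2E x : g2 x = r - x :> nat by rewrite inordK //; lia.
have g1_inj : injective g1.
  by move=> x y /(congr1 val); rewrite /= !g1E => /val_inj.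
have g2_inj : injective g2.
  move=> x y /(congr1 val); rewrite /= !g2E => E; apply: val_inj => /=.
  by have := ltn_ord x; have := ltn_ord y; lia.
pose W := [set x | g1 x \in edge_gaps] :|: [set x | g2 x \in edge_gaps].
have pre (g : 'I_r.+1 -> 'I_alpha) : injective g ->
    #|[set x | g x \in edge_gaps]| <= #|edge_gaps|.
  move=> gi; rewrite -(card_imset _ gi); apply/subset_leq_card/subsetP => y.
  by case/imsetP => z; rewrite inE => zg ->.
case: (pickP (fun x => x \notin W)) => [x|H]; last first.
  have : #|[set: 'I_r.+1]| <= #|W|.
    by apply/subset_leq_card/subsetP => x _; apply: (negbFE (H x)).
  rewrite cardsT card_ord cardsU => HW.
  by have := pre _ g1_inj; have := pre _ g2_inj; lia.
move=> xW; have h1 : g1 x \notin edge_gaps.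
  by apply: contra xW => h; rewrite in_setU; apply/orP; left; rewrite in_set.
have h2 : g2 x \notin edge_gaps.
  by apply: contra xW => h; rewrite in_setU; apply/orP; right; rewrite in_set.
have gap (z : 'I_alpha) y : z = y :> nat -> z \notin edge_gaps ->
    y = 0 \/ exists i, A i p = y.
  by move=> <-; case: z => z lt_z; exact: not_gap.
exists (x : nat), (r - x); split; first by have := ltn_ord x; lia.
  exact: gap (g1E x) h1.
exact: gap (g2E x) h2.
Qed.

(** If the residue r of the p-coordinate is large, it is the sum of the
    p-coordinates of two generators, and the rest of the sum is made of
    vertices; the condition on the quotient ensures that enough of the
    q-coordinate is left for these two generators. *)
Lemma irreducible_low (s : seq 'I_c) : ~ reducible alpha A s -> 2 < size s ->
  (\sum_(i <- s) A i)%MM p %/ alpha + 2 <= size s ->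
  (\sum_(i <- s) A i)%MM p %% alpha < 2 * #|edge_gaps|.
Proof.
move=> irr s3; set S := (\sum_(i <- s) A i)%MM; set m := S p %/ alpha => szs.
rewrite ltnNge; apply/negP => gr; apply: irr.
have [|x [y [xy hx hy]]] := pair_avoiding_gaps (r := S p %% alpha).
  by rewrite gr ltn_pmod.
have part z : z = 0 \/ (exists i, A i p = z) -> exists f, size f <= 1 /\
    (\sum_(i <- f) A i)%MM p = z.
  case=> [->|[i <-]]; last by exists [:: i]; rewrite big_seq1.
  by exists [::]; rewrite big_nil mnm0E.
have [fx [sx Ex]] := part x hx; have [fy [sy Ey]] := part y hy.
have SE : S p + S q = alpha * size s by rewrite -(mdeg_two _ pq pqP) (mdeg_sumA A_deg).
have fE f : (\sum_(i <- f) A i)%MM p + (\sum_(i <- f) A i)%MM q = alpha * size f.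
  by rewrite -(mdeg_two _ pq pqP) (mdeg_sumA A_deg).
(* the number of copies of the vertex of q, after m copies of that of p *)
pose l := size s - m - size fx - size fy.
exists (fx ++ fy), (U_(p) *+ m + U_(q) *+ l)%MM; split.
  apply/eqP => w0; move/mnmP: (w0) => /(_ p); move/mnmP: w0 => /(_ q).
  rewrite !mnmDE !mulmnE !mnm1E !mnm0E !eqxx [q == p]eq_sym (negbTE pq).
  by rewrite /l; lia.
have dv := divn_eq (S p) alpha; rewrite -/m in dv.
apply/mnmP => k; case: (pqP k) => ->; rewrite mnmDE mulmnE mnmDE !mulmnE !mnm1E.
  rewrite eqxx [q == p]eq_sym (negbTE pq) big_cat mnmDE /= Ex Ey xy -/S {1}dv; lia.
rewrite eqxx (negbTE pq) big_cat mnmDE /= -/S /l.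
have := fE fx; have := fE fy; rewrite Ex Ey; nia.
Qed.

End OneSide.

(** Applying irreducible_low to both coordinates forces the quotient of one
    of them to be 0, since two residues below 2 g cannot add up to alpha. *)
Lemma irreducible_one_sided (p q : 'I_n) (s : seq 'I_c) : p != q ->
  (forall k, k = p \/ k = q) -> ~ reducible alpha A s -> 2 < size s ->
  forall g, g + c.+1 = alpha -> 4 * g < alpha ->
  (\sum_(i <- s) A i)%MM p < 2 * g \/ (\sum_(i <- s) A i)%MM q < 2 * g.
Proof.
move=> pq pqP irr s3 g gc ga.
have qp : q != p by rewrite eq_sym.
have qpP k : k = q \/ k = p by case: (pqP k); [right | left].
have gp : #|edge_gaps p| = g by have := card_edge_gaps pq pqP; lia.
have gq : #|edge_gaps q| = g by have := card_edge_gaps qp qpP; lia.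
have lowp := irreducible_low pq pqP irr s3; have lowq := irreducible_low qp qpP irr s3.
rewrite gp in lowp; rewrite gq in lowq.
set S := (\sum_(i <- s) A i)%MM in lowp lowq *.
have SE : S p + S q = alpha * size s by rewrite -(mdeg_two _ pq pqP) (mdeg_sumA A_deg).
have r0 : S p %% alpha != 0.
  apply/eqP => r0; apply: irr; exists [::], [multinom S k %/ alpha | k < n].
  have dvp := divn_eq (S p) alpha; rewrite r0 addn0 in dvp.
  have dq : alpha %| S q.
    have : alpha %| S p + S q by rewrite SE dvdn_mulr.
    by rewrite dvdn_addr // /dvdn r0.
  split.
    apply/eqP => w0; move/mnmP: (w0) => /(_ p); move/mnmP: w0 => /(_ q).
    rewrite !mnmE ?mnm0E.
    move=> q0 p0; move: SE; rewrite -(divnK dq) q0 dvp p0; lia.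
  rewrite big_nil add0m -/S; apply/mnmP => k; rewrite mulmnE mnmE.
  by case: (pqP k) => ->; [rewrite {1}dvp | rewrite divnK].
have dvp := divn_eq (S p) alpha; have dvq := divn_eq (S q) alpha.
have rp : S p %% alpha < alpha by rewrite ltn_pmod.
have rq : S q %% alpha < alpha by rewrite ltn_pmod.
move: dvp dvq rp rq r0 lowp lowq.
move: (S p %% alpha) (S p %/ alpha) (S q %% alpha) (S q %/ alpha) => r m r' m'.
move=> dvp dvq rp rq r0 lowp lowq.
(* r + r' is a multiple of alpha with 0 < r and r, r' < alpha *)
have sum_r : r + r' = alpha /\ m + m' + 1 = size s.
  have E : (m + m') * alpha + (r + r') = alpha * size s by rewrite -SE dvp dvq; nia.
  have [lt|ge] := ltnP (m + m') (size s); last by nia.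
  have [lt2|ge2] := ltnP (m + m' + 1) (size s); first by nia.
  have E2 : m + m' + 1 = size s by lia.
  by split=> //; nia.
case: sum_r => sr sm.
have [m_lt|m_ge] := leqP (m + 2) (size s); last first.
  have m'0 : m' = 0 by lia.
  by right; have := lowq (ltac:(lia)); rewrite dvq m'0; lia.
have [m'_lt|m'_ge] := leqP (m' + 2) (size s); last first.
  have m0 : m = 0 by lia.
  by left; have := lowp m_lt; rewrite dvp m0; lia.
by have := lowp m_lt; have := lowq m'_lt; lia.
Qed.

(** The first sum is at least alpha in the coordinate q and the second one in
    the coordinate p, so they are small in p and in q respectively; being
    congruent to minus each other modulo alpha, these small values vanish, and
    the first sum is a multiple of a vertex. *)
Lemma two_coordinates_short (p q : 'I_n) (s s' : seq 'I_c) (v v' : 'X_{1..n}) :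
  p != q -> (forall k, k = p \/ k = q) ->
  ~ reducible alpha A s -> ~ reducible alpha A s' ->
  (\sum_(i <- s) A i + v *+ alpha = \sum_(i <- s') A i + v' *+ alpha)%MM ->
  0 < v p -> v' p = 0 -> v q = 0 -> 0 < v' q ->
  forall g, g + c.+1 = alpha -> 4 * g < alpha ->
  size s <= 2 \/ size s' <= 2.
Proof.
move=> pq pqP irr irr' E vp v'p vq v'q g gc ga.
have [s2|s3] := leqP (size s) 2; first by left.
have [s2'|s3'] := leqP (size s') 2; first by right.
have one := irreducible_one_sided pq pqP irr s3 gc ga.
have one' := irreducible_one_sided pq pqP irr' s3' gc ga.
have SE : (\sum_(i <- s) A i)%MM p + (\sum_(i <- s) A i)%MM q = alpha * size s.
  by rewrite -(mdeg_two _ pq pqP) (mdeg_sumA A_deg).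
move/mnmP: E => E; have := E p; have := E q.
rewrite !mnmDE !mulmnE vq v'p !mul0n !addn0.
set S := (\sum_(i <- s) A i)%MM in one SE *; set S' := (\sum_(i <- s') A i)%MM in one' *.
move=> Eq Ep.
have aq : alpha <= v' q * alpha by rewrite leq_pmull.
have ap : alpha <= v p * alpha by rewrite leq_pmull.
have Sq : S q < 2 * g -> False by lia.
have S'p : S' p < 2 * g -> False by lia.
case: one => // Sp; case: one' => // S'q.
have low0 : S p + S' q = 0.
  have : S p + S' q + v' q * alpha = alpha * size s by rewrite -SE Eq addnA.
  have : S p + S' q < alpha by lia.
  move: (S p + S' q) => x xa H.
  by have := congr1 (modn^~ alpha) H; rewrite addnC modnMDl modnMr modn_small.
have Sp0 : S p = 0 by lia.
have S'q0 : S' q = 0 by lia.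
exfalso; apply: irr; exists [::], (U_(q) *+ v' q)%MM; split.
  by apply/eqP => /mnmP/(_ q); rewrite mulmnE mnm1E eqxx mnm0E; lia.
rewrite big_nil add0m -/S; apply/mnmP => k; rewrite !mulmnE mnm1E.
case: (pqP k) => ->; first by rewrite [q == p]eq_sym (negbTE pq) Sp0.
by rewrite eqxx Eq S'q0; lia.
Qed.

End TwoCoordinates.

(** * Minimal nonstandard monomials *)

Section Grevlex.

Variable n : nat.
Implicit Types u v w : 'X_{1..n}.

Lemma grevlex_irr u : grevlex_lt u u = false.
Proof.
rewrite /grevlex_lt ltnn eqxx /=; apply/existsP => -[i].
by rewrite ltnn.
Qed.

Lemma grevlex_trans u v w : grevlex_lt u v -> grevlex_lt v w -> grevlex_lt u w.
Proof.
rewrite /grevlex_lt => /orP[uv|/andP[/eqP uv /existsP[i /andP[vi /forallP Hi]]]].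
  by case/orP => [vw|/andP[/eqP <- _]]; rewrite ?uv ?(ltn_trans uv vw).
rewrite uv; case/orP => [->//|/andP[-> /existsP[j /andP[wj /forallP Hj]]]].
apply/orP; right => /=; apply/existsP.
have [ij|ji|/val_inj E] := ltngtP i j.
- exists j; rewrite (eqP (implyP (Hi j) ij)) wj; apply/forallP => k.
  apply/implyP => jk; rewrite (eqP (implyP (Hi k) (ltn_trans ij jk))).
  exact: (implyP (Hj k)).
- exists i; rewrite -(eqP (implyP (Hj i) ji)) vi; apply/forallP => k.
  apply/implyP => ik; rewrite (eqP (implyP (Hi k) ik)).
  exact: (implyP (Hj k) (ltn_trans ji ik)).
- exists i; rewrite E in vi Hi *; rewrite (ltn_trans wj vi); apply/forallP => k.
  apply/implyP => ik; rewrite (eqP (implyP (Hi k) ik)).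
  exact: (implyP (Hj k)).
Qed.

Lemma grevlexD2r u v w : grevlex_lt (u + w)%MM (v + w)%MM = grevlex_lt u v.
Proof.
rewrite /grevlex_lt !mdegD ltn_add2r eqn_add2r; congr (_ || _ && _).
apply: eq_existsb => i; rewrite !mnmDE ltn_add2r; congr (_ && _).
by apply: eq_forallb => j; rewrite !mnmDE eqn_add2r.
Qed.

End Grevlex.

Section Monomials.

Variables (K : fieldType) (c d alpha : nat) (a : 'I_c -> 'X_{1..d}).
Hypothesis alpha_gt0 : (0 < alpha)%N.
Hypothesis a_deg : forall i, mdeg (a i) = alpha.

Implicit Types m w : 'X_{1..c + d}.

(** The exponent of the image of the monomial under x_i |-> t^a_i,
    y_j |-> t_j^alpha. *)
Definition weight (w : 'X_{1..c + d}) : 'X_{1..d} :=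
  (\sum_(j < c + d) generator alpha a j *+ w j)%MM.

Definition xseq (w : 'X_{1..c + d}) : seq 'I_c :=
  flatten [seq nseq (w (lshift d i)) i | i <- enum 'I_c].

Definition ypart (w : 'X_{1..c + d}) : 'X_{1..d} := [multinom w (rshift c k) | k < d].

Definition xymon (s : seq 'I_c) (v : 'X_{1..d}) : 'X_{1..c + d} :=
  [multinom match split j with inl i => count_mem i s | inr k => v k end | j < c + d].

Lemma weightD w1 w2 : weight (w1 + w2)%MM = (weight w1 + weight w2)%MM.
Proof.
rewrite /weight -big_split; apply: eq_bigr => j _ /=.
by apply/mnmP => k; rewrite !(mnmDE, mulmnE) mulnDr.
Qed.

Lemma sum_nseq (s : seq 'I_c) (f : 'I_c -> nat) :
  (\sum_(i <- flatten [seq nseq (f i) i | i <- s]) a i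
    = \sum_(i <- s) a i *+ f i)%MM.
Proof.
elim: s => [|i s IH] /=; first by rewrite !big_nil.
rewrite big_cat big_cons IH /=; congr (_ + _)%MM.
apply/mnmP => k; rewrite mnm_sumE mulmnE big_nseq; elim: (f i) => [|x IHx] /=.
  by rewrite muln0.
by rewrite IHx mulnS.
Qed.

Lemma weightE w : (weight w = \sum_(i <- xseq w) a i + ypart w *+ alpha)%MM.
Proof.
rewrite /weight big_split_ord /=; congr (_ + _)%MM.
  rewrite /xseq sum_nseq big_enum /=; apply: eq_bigr => i _.
  by rewrite /generator (unsplitK (inl i)).
apply/mnmP => k; rewrite mnm_sumE mulmnE mnmE (bigD1 k) //= big1 ?addn0.
  by rewrite /generator (unsplitK (inr k)) !mulmnE mnm1E eqxx mul1n mulnC.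
move=> j jk; rewrite /generator (unsplitK (inr j)) !mulmnE mnm1E.
by rewrite (negbTE jk).
Qed.

Lemma size_xseq w : (size (xseq w) + mdeg (ypart w) = mdeg w)%N.
Proof.
rewrite !mdegE big_split_ord /=; congr (_ + _)%N; last first.
  by apply: eq_bigr => k _; rewrite mnmE.
rewrite size_flatten /shape -map_comp sumnE big_map big_enum /=.
by apply: eq_bigr => i _; rewrite size_nseq.
Qed.

Lemma mdeg_weight w : mdeg (weight w) = (alpha * mdeg w)%N.
Proof. by rewrite weightE mdegD mdegMn (mdeg_sumA a_deg) -size_xseq; lia. Qed.

Lemma weight_mdeg w1 w2 : weight w1 = weight w2 -> mdeg w1 = mdeg w2.
Proof.
by move=> /(congr1 mdeg)/eqP; rewrite !mdeg_weight eqn_pmul2l // => /eqP.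
Qed.

Lemma xymon_x s v i : xymon s v (lshift d i) = count_mem i s.
Proof. by rewrite mnmE (unsplitK (inl i)). Qed.

Lemma xymon_y s v k : xymon s v (rshift c k) = v k.
Proof. by rewrite mnmE (unsplitK (inr k)). Qed.

Lemma ypart_xymon s v : ypart (xymon s v) = v.
Proof. by apply/mnmP => k; rewrite mnmE xymon_y. Qed.

Lemma count_xseq w i : count_mem i (xseq w) = w (lshift d i).
Proof.
rewrite count_flatten -map_comp sumnE big_map big_enum /= (bigD1 i) //=.
rewrite big1 ?addn0 => [|j ji]; rewrite count_nseq /= ?eqxx ?mul1n //.
by rewrite (negbTE ji).
Qed.

Lemma perm_xseq_xymon s v : perm_eq (xseq (xymon s v)) s.
Proof. by apply/allP => i _ /=; rewrite count_xseq xymon_x. Qed.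

Lemma weight_xymon s v : (weight (xymon s v) = \sum_(i <- s) a i + v *+ alpha)%MM.
Proof. by rewrite weightE ypart_xymon (perm_big _ (perm_xseq_xymon s v)). Qed.

Lemma weight_xymon0 s : weight (xymon s 0%MM) = (\sum_(i <- s) a i)%MM.
Proof.
rewrite weight_xymon; apply/mnmP => k.
by rewrite mnmDE mulmnE mnm0E mul0n addn0.
Qed.

Lemma xymon_xseq w : xymon (xseq w) (ypart w) = w.
Proof.
apply/mnmP => j; rewrite mnmE -{2}(splitK j); case: (split j) => k /=.
  by rewrite count_xseq.
by rewrite mnmE.
Qed.

(** These are the monomials of the initial ideal; see initial_nonstandard and
    nonstandard_initial. *)
Definition nonstandard (m : 'X_{1..c + d}) : Prop :=
  exists2 w, weight w = weight m & grevlex_lt w m.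

Lemma nonstandard_le m1 m2 : (m1 <= m2)%MM -> nonstandard m1 -> nonstandard m2.
Proof.
move=> le12 [w E lt]; exists (w + (m2 - m1))%MM.
  by rewrite weightD E -weightD addmC submK.
by rewrite -{2}(submK le12) [X in grevlex_lt _ X]addmC grevlexD2r.
Qed.

(** The last variable in which the two monomials differ is a y, and it occurs
    only in the rewritten one. *)
Lemma reducible_nonstandard s : reducible alpha a s -> nonstandard (xymon s 0%MM).
Proof.
move=> [f [v [v0 E]]]; exists (xymon f v); first by rewrite weight_xymon weight_xymon0 E.
have Edeg : mdeg (xymon f v) = mdeg (xymon s 0%MM).
  by apply: weight_mdeg; rewrite weight_xymon weight_xymon0 E.
rewrite /grevlex_lt Edeg eqxx ltnn /=.
have [k0 vk0] : exists k, v k != 0%N.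
  apply/existsP; rewrite -negb_forall; apply: contra v0 => /forallP v0.
  by apply/eqP/mnmP => k; rewrite mnm0E; apply/eqP.
have [k vk kmax] := @arg_maxnP _ k0 (fun k => v k != 0%N) (fun k => k : nat) vk0.
apply/existsP; exists (rshift c k); rewrite !xymon_y mnm0E lt0n vk.
apply/forallP => j; apply/implyP; rewrite -(splitK j); case: (split j) => l /=.
  by have := ltn_ord l; lia.
rewrite ltn_add2l => kl; rewrite !xymon_y mnm0E; apply: contraTT kl => vl.
by rewrite -leqNgt; exact: kmax.
Qed.

Lemma standard_irreducible m : ~ nonstandard m -> ~ reducible alpha a (xseq m).
Proof.
move=> st /reducible_nonstandard; apply: contra_not st; apply: nonstandard_le.
apply/mnm_lepP => j; rewrite -{2}(xymon_xseq m) !mnmE.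
by case: (split j) => k //; rewrite mnm0E.
Qed.

(** The order restricted to a fixed degree is finite, so descending in a fibre
    of the weight terminates. *)
Lemma standard_representative m : nonstandard m ->
  exists w, [/\ weight w = weight m, grevlex_lt w m & ~ nonstandard w].
Proof.
set D := (mdeg m).+1.
pose rank w := #|[set x : bmultinom (c + d) D | grevlex_lt x w]|.
suff H r : forall m', (rank m' < r)%N -> mdeg m' = mdeg m -> nonstandard m' ->
    exists w, [/\ weight w = weight m', grevlex_lt w m' & ~ nonstandard w].
  by apply: (H (rank m).+1).
elim: r => // r IH m' rk Dm [w E lt].
have [nw|st] := classic (nonstandard w); last by exists w.
have Dw : mdeg w = mdeg m by rewrite (weight_mdeg E).
have ltD : (mdeg w < D)%N by rewrite Dw.
have [|w' [E' lt' st']] := IH w _ Dw nw; last first.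
  by exists w'; split=> //; [rewrite E' | exact: grevlex_trans lt' lt].
apply: (@leq_trans (rank m')); last by rewrite -ltnS.
apply: proper_card; apply/properP; split.
  by apply/subsetP => x; rewrite !inE => /grevlex_trans; apply.
by exists (BMultinom ltD); rewrite inE /= ?grevlex_irr.
Qed.

Section DegreeBound.

Variable N : nat.
Hypothesis irr_size : forall s, ~ reducible alpha a s -> (size s + c <= N)%N.
Hypothesis irr_pair : forall s s' (v v' : 'X_{1..d}) k k',
  ~ reducible alpha a s -> ~ reducible alpha a s' ->
  (\sum_(i <- s) a i + v *+ alpha = \sum_(i <- s') a i + v' *+ alpha)%MM ->
  (0 < v k)%N -> v' k = 0%N -> v k' = 0%N -> (0 < v' k')%N ->
  (size s + size s' + c <= N + 2)%N.

(** The reduction to irreducible sequences: m and a standard monomial w of the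
    same weight are coprime by minimality of m, and the y-part of m is bounded
    by the x-part of w. *)
Lemma minimal_nonstandard_degree m : nonstandard m ->
  (forall m', (m' <= m)%MM -> nonstandard m' -> m' = m) ->
  (mdeg m + c <= N.+1)%N.
Proof.
move=> nm m_min; have [w [E lt st]] := standard_representative nm.
have disj j : (0 < m j)%N -> (0 < w j)%N -> False.
  move=> mj wj; have Um : (U_(j) <= m)%MM.
    by apply/mnm_lepP => i; rewrite mnm1E; case: eqP => // <-.
  have Uw : (U_(j) <= w)%MM.
    by apply/mnm_lepP => i; rewrite mnm1E; case: eqP => // <-.
  have : (m - U_(j))%MM = m.
    apply: m_min; first by apply/mnm_lepP => i; rewrite mnmBE leq_subr.
    exists (w - U_(j))%MM; last by rewrite -(grevlexD2r _ _ U_(j)) !submK.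
    move: E; rewrite -{1}(submK Uw) -{1}(submK Um) !weightD.
    by move=> /mnmP E; apply/mnmP => i; have := E i; rewrite !mnmDE => /addIn.
  by move=> /mnmP/(_ j); rewrite mnmBE mnm1E eqxx; lia.
have EE := E; rewrite !weightE in EE; move/mnmP: (EE) => EEl.
have Edeg := weight_mdeg E; rewrite -!size_xseq in Edeg *.
have [y0|y_neq0] := eqVneq (ypart m) 0%MM.
  rewrite y0 mdeg0 addn0; case Es : (xseq m) => [|i s].
    have [|H] := classic (reducible alpha a [::]); last by have := irr_size H; lia.
    case=> f [v [v0]]; rewrite big_nil => /(congr1 mdeg).
    rewrite mdeg0 mdegD mdegMn (mdeg_sumA a_deg) => /esym/eqP.
    rewrite addn_eq0 !muln_eq0 => /andP[_ /orP[|/eqP]]; last by lia.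
    by rewrite mdeg_eq0 (negbTE v0).
  have mE := xymon_xseq m; rewrite y0 Es in mE.
  suff /irr_size : ~ reducible alpha a s by rewrite /=; lia.
  move=> /reducible_nonstandard/m_min; rewrite -mE => H.
  have /H/(congr1 mdeg)/eqP : (xymon s 0 <= xymon (i :: s) 0)%MM.
    apply/mnm_lepP => j; rewrite !mnmE; case: (split j) => // k /=.
    exact: leq_addl.
  rewrite -!size_xseq !ypart_xymon !(perm_size (perm_xseq_xymon _ _)) /=.
  by rewrite mdeg0 !addn0; lia.
have irr_m : ~ reducible alpha a (xseq m).
  move=> /reducible_nonstandard/m_min H; move: y_neq0.
  suff /H <- : (xymon (xseq m) 0 <= m)%MM by rewrite ypart_xymon eqxx.
  apply/mnm_lepP => j; rewrite -{2}(xymon_xseq m) !mnmE.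
  by case: (split j) => // k; rewrite mnm0E.
have irr_w := standard_irreducible st.
have [k yk] : exists k, (0 < ypart m k)%N.
  apply/existsP; move: y_neq0; apply: contraNT; rewrite negb_exists => /forallP H.
  by apply/eqP/mnmP => k; have := H k; rewrite mnm0E lt0n negbK => /eqP.
have ydisj l : (0 < ypart m l)%N -> ypart w l = 0%N.
  rewrite !mnmE => ml; apply/eqP; rewrite -leqn0 leqNgt; apply/negP; exact: disj ml.
(* the last variable in which m and w differ comes after some y dividing m *)
have [k' [yk' yk'0]] : exists k', (0 < ypart w k')%N /\ ypart m k' = 0%N.
  move: lt; rewrite /grevlex_lt -!size_xseq Edeg ltnn eqxx /=.
  case/existsP => j /andP[mj /forallP Hj].
  have mj0 : m j = 0%N.
    by apply/eqP; rewrite -leqn0 leqNgt; apply/negP => h; apply: (disj j) => //; lia.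
  have jk : ~ (j < rshift c k)%N.
    move=> jk; have := implyP (Hj (rshift c k)) jk.
    by have := ydisj _ yk; move: yk; rewrite !mnmE => m0 ->; lia.
  move: mj mj0 jk; rewrite -(splitK j); case: (split j) => l /= mj mj0 jk.
    by have := ltn_ord l; lia.
  by exists l; rewrite !mnmE; split=> //; lia.
(* equality would make the x-part of w a sum of vertices *)
have yw : (mdeg (ypart m) < size (xseq w))%N.
  rewrite ltnNge; apply/negP => le; apply: irr_w.
  have lek : (ypart m *+ alpha <= \sum_(i <- xseq w) a i)%MM.
    apply/mnm_lepP => l; have := EEl l; rewrite !mnmDE !mulmnE.
    have [->//|/ydisj ->] := posnP (ypart m l); lia.
  exists [::], (ypart m); split=> //; rewrite big_nil add0m.
  apply/eqP; rewrite eq_sym -[eqbRHS](submK lek) -{1}[(_ *+ _)%MM]add0m eqm_add2r.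
  rewrite eq_sym -mdeg_eq0; have := congr1 mdeg (submK lek).
  rewrite mdegD mdegMn (mdeg_sumA a_deg); nia.
have := irr_pair irr_m irr_w (esym EE) yk (ydisj _ yk) yk'0 yk'; lia.
Qed.

End DegreeBound.

End Monomials.

(** * The toric ideal: initial ideal and codimension *)

Section ToricIdeal.

Variables (K : fieldType) (c d alpha : nat) (a : 'I_c -> 'X_{1..d}).

Local Notation I := (toric_ideal K alpha a).
Local Notation gens := [tuple 'X_[generator alpha a v] | v < c + d].
Local Notation weight := (weight alpha a).
Local Notation nonstandard := (nonstandard alpha a).

Lemma comp_monomial (w : 'X_{1..c + d}) :
  ('X_[w] : {mpoly K[c + d]}) \mPo gens = 'X_[weight w].
Proof.
rewrite comp_mpolyX -mprodXE; apply: eq_bigr => j _.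
by rewrite tnth_mktuple mpolyXn.
Qed.

(** The coefficient of t^(weight m) in the image of p is zero, so another
    monomial of p must have the same weight as m. *)
Lemma leading_nonstandard (p : {mpoly K[c + d]}) m :
  p \in I -> leading_monomial p m -> nonstandard m.
Proof.
move=> /eqP p0 [mp lead].
have [/hasP[w wp /andP[wm /eqP E]]|no] := boolP
  (has (fun w => (w != m) && (weight w == weight m)) (msupp p)).
  by exists w => //; exact: lead.
have := congr1 (mcoeff (weight m)) p0.
rewrite comp_mpolyEX mcoeff0 linear_sum (bigD1_seq m) ?msupp_uniq //=.
rewrite big1_seq ?addr0 => [|w /andP[wm wp]].
  rewrite mcoeffZ comp_monomial mcoeffX eqxx mulr1 => E.
  by move: mp; rewrite mcoeff_msupp E eqxx.
rewrite mcoeffZ comp_monomial mcoeffX.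
have := hasPn no w wp; rewrite wm /= => /negbTE ->; exact: mulr0.
Qed.

Lemma initial_nonstandard m : initial_ideal I ('X_[m]) -> nonstandard m.
Proof.
move=> [r [h [ms [lead E]]]].
have [i /eqP hi|no] := pickP (fun i => (ms i <= m)%MM); last first.
  have := congr1 (mcoeff m) E; rewrite mcoeffX eqxx linear_sum big1 /=.
    by move/eqP; rewrite oner_eq0.
  move=> i _; rewrite memN_msupp_eq0 //; apply/negP => /msuppM_le/allpairsP[[m1 m2]].
  move=> /= [_]; rewrite msuppX inE => /eqP -> Em.
  by have := no i; rewrite Em lem_addl.
have [p pI lp] := lead i.
by apply: (nonstandard_le (m1 := ms i)); [apply/eqP | exact: leading_nonstandard lp].
Qed.

Lemma nonstandard_initial m : nonstandard m -> initial_ideal I ('X_[m]).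
Proof.
move=> [w E lt]; exists 1%N, (fun=> 1), (fun=> m); split; last first.
  by rewrite big_ord1 mul1r.
move=> _; have mw : m != w by apply: contraTneq lt => ->; rewrite grevlex_irr.
exists ('X_[m] - 'X_[w]).
  by rewrite inE raddfB /= !comp_monomial E subrr.
split.
  rewrite mcoeff_msupp mcoeffB !mcoeffX eqxx [w == m]eq_sym (negbTE mw) subr0.
  exact: oner_neq0.
move=> m'; rewrite mcoeff_msupp mcoeffB !mcoeffX => + m'm.
rewrite [m == m']eq_sym (negbTE m'm) sub0r oppr_eq0.
by have [<-|] := eqVneq w m'; rewrite ?eqxx.
Qed.

Hypothesis alpha_gt0 : (0 < alpha)%N.
Hypothesis a_deg : forall i, mdeg (a i) = alpha.

Lemma max_groebner_degree_exists (i0 : 'I_c) (D : nat) :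
  (forall m, nonstandard m ->
     (forall m', (m' <= m)%MM -> nonstandard m' -> m' = m) -> (mdeg m <= D)%N) ->
  exists2 D', max_groebner_degree I D' & (D' <= D)%N.
Proof.
move=> bound; have gen_ns m : minimal_generator (initial_ideal I) m <->
    nonstandard m /\ forall m', (m' <= m)%MM -> nonstandard m' -> m' = m.
  split=> -[H1 H2]; split; first exact: initial_nonstandard.
  - by move=> m' le /nonstandard_initial; exact: H2.
  - exact: nonstandard_initial.
  - by move=> m' le /initial_nonstandard; exact: H2.
have min_exists n : forall m, (mdeg m <= n)%N -> nonstandard m ->
    exists m0, minimal_generator (initial_ideal I) m0.
  elim: n => [|n IH] m mn ns;
    (have [[m' [le [ns' ne]]]|H] := classic (exists m', (m' <= m)%MM /\
      nonstandard m' /\ m' <> m); last first);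
    try by exists m; apply/gen_ns; split=> // m' le ns';
      apply: NNPP => ne; apply: H; exists m'.
  - have m0 : m = 0%MM by apply/eqP; rewrite -mdeg_eq0 -leqn0.
    case: ne; rewrite m0; apply/mnmP => i; rewrite mnm0E; apply/eqP.
    by rewrite -leqn0; have := mnm_lepP le i; rewrite m0 mnm0E.
  - apply: (IH m') => //; rewrite -ltnS; apply: leq_trans mn.
    rewrite -(submK le) mdegD -[ltnLHS]add0n ltn_add2r lt0n mdeg_eq0.
    apply/eqP => E0; case: ne; rewrite -[RHS](submK le) E0; apply/mnmP => i.
    by rewrite mnmDE mnm0E.
(* the power x_i0^alpha rewrites to a monomial in the y's *)
have [m0 gen0] : exists m0, minimal_generator (initial_ideal I) m0.
  apply: (min_exists _ (xymon (nseq alpha i0) 0%MM) (leqnn _)).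
  apply: reducible_nonstandard => //.
  exists [::], (a i0); split; first by rewrite -mdeg_eq0 a_deg -lt0n.
  rewrite big_nil add0m; apply/mnmP => k; rewrite mnm_sumE mulmnE big_nseq.
  by elim: (alpha) => [|n IH] /=; rewrite ?muln0 // IH mulnS.
have [D' [gD' maxD']] : exists D', (exists2 m, minimal_generator (initial_ideal I) m
     & mdeg m = D') /\ forall m, minimal_generator (initial_ideal I) m -> (mdeg m <= D')%N.
  have : forall m, minimal_generator (initial_ideal I) m -> (mdeg m <= D)%N.
    by move=> m /gen_ns[]; exact: bound.
  elim: (D) => [|n IH] Hn.
    exists 0%N; split=> //; exists m0 => //; apply/eqP.
    by rewrite -leqn0; exact: Hn.
  have [[m [gm Em]]|H] := classic (exists m, minimal_generator (initial_ideal I) m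
      /\ mdeg m = n.+1).
    by exists n.+1; split=> //; exists m.
  apply: IH => m gm; have := Hn m gm; rewrite leq_eqVlt => /orP[/eqP Em|//].
  by case: H; exists m.
exists D'; first by split.
by case: gD' => m /gen_ns[h1 h2] <-; exact: bound.
Qed.

End ToricIdeal.

Section Codimension.

Variables (K : fieldType) (c d alpha : nat) (a : 'I_c -> 'X_{1..d}).
Hypothesis alpha_gt0 : (0 < alpha)%N.

Local Notation I := (toric_ideal K alpha a).
Local Notation gens := [tuple 'X_[generator alpha a v] | v < c + d].

Let trunc (i : nat) : d.-tuple {mpoly K[d]} :=
  [tuple if (k < i)%N then 0 else 'X_k | k < d].

Let P (i : nat) : {pred {mpoly K[c + d]}} :=
  [pred p | (p \mPo gens) \mPo trunc i == 0].

(** P i is the kernel of the parametrization followed by t_k = 0 for k < i;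
    the variable mapped to t_i^alpha separates P i from P (i + 1). *)
Lemma prime_chain_toric : prime_chain I d.
Proof.
have truncK i (p : {mpoly K[d]}) : (p \mPo trunc i) \mPo trunc i.+1 = p \mPo trunc i.+1.
  rewrite [p \mPo trunc i]comp_mpolyE [RHS]comp_mpolyE raddf_sum; apply: eq_bigr => m _.
  rewrite /= comp_mpolyZ rmorph_prod; congr (_ *: _); apply: eq_bigr => k _.
  rewrite rmorphXn /= !tnth_mktuple; congr (_ ^+ _).
  have [ki|ki] := ltnP k i; first by rewrite comp_mpoly0 leqW.
  by rewrite comp_mpolyXU -tnth_nth tnth_mktuple.
exists P; split=> [i _|i id].
  split; last by move=> p /eqP p0; rewrite inE p0 comp_mpoly0.
  split; first split.
  - by rewrite inE !comp_mpoly0.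
  - by rewrite inE !comp_mpoly1 oner_eq0.
  - move=> r u v; rewrite !inE => /eqP u0 /eqP v0.
    by rewrite !rmorphD !rmorphM /= u0 v0 mulr0 addr0.
  by move=> u v; rewrite !inE !rmorphM mulf_eq0.
split.
  by move=> p; rewrite !inE => /eqP p0; rewrite -truncK p0 comp_mpoly0.
move=> H; have := H 'X_(rshift c (Ordinal id)).
have E : ('X_(rshift c (Ordinal id)) : {mpoly K[c + d]}) \mPo gens
    = 'X_(Ordinal id) ^+ alpha.
  by rewrite comp_mpolyXU -tnth_nth tnth_mktuple /generator (unsplitK (inr _)) mpolyXn.
rewrite !inE E !rmorphXn /= !comp_mpolyXU -!tnth_nth !tnth_mktuple /= ltnSn ltnn.
rewrite expr0n (gtn_eqF alpha_gt0) eqxx => /(_ isT).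
rewrite expf_eq0 => /andP[_ /eqP/(congr1 (mcoeff U_(Ordinal id)))/eqP].
by rewrite mcoeffX eqxx mcoeff0 oner_eq0.
Qed.

Lemma codim_le (k : nat) : codim I k -> (k <= c)%N.
Proof. by case=> m [_ /(_ d prime_chain_toric)] dm mk; lia. Qed.

End Codimension.

(** * Edges of the simplex *)

Section EdgeGeometry.

Variables (R : realFieldType) (c d alpha : nat) (a : 'I_c -> 'X_{1..d}).
Hypothesis alpha_gt0 : (0 < alpha)%N.
Hypothesis a_deg : forall i, mdeg (a i) = alpha.
Hypothesis gen_inj : injective (generator alpha a).
Variable I : {set 'I_d}.

Local Notation gen := (generator alpha a).
Local Notation face := (face_points alpha a I).

Lemma gen_deg v : mdeg (gen v) = alpha.
Proof.
by rewrite /generator; case: (split v) => // k; rewrite mdegMn mdeg1 mul1n.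
Qed.

Lemma gen_vertex k : gen (rshift c k) = (U_(k) *+ alpha)%MM.
Proof. by rewrite /generator (unsplitK (inr k)). Qed.

Lemma gen_point i : gen (lshift d i) = a i.
Proof. by rewrite /generator (unsplitK (inl i)). Qed.

Lemma face_vertex k : k \notin I -> (U_(k) *+ alpha)%MM \in face.
Proof.
move=> kI; rewrite mem_filter -gen_vertex codom_f andbT gen_vertex.
apply/forall_inP => i iI; rewrite mulmnE mnm1E.
by rewrite (_ : (k == i) = false) //; apply: contraNF kI => /eqP ->.
Qed.

Lemma face_deg x : x \in face -> mdeg x = alpha.
Proof. by rewrite mem_filter => /andP[_ /codomP[v ->]]; exact: gen_deg. Qed.

Lemma face_uniq : uniq face.
Proof. by rewrite filter_uniq // map_inj_uniq ?enum_uniq. Qed.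

Lemma pointE (x : 'X_{1..d}) k : point R x ord0 k = (x k)%:R.
Proof. by rewrite mxE. Qed.

(** Three vertices on the face give two independent directions, and a face
    with at most one vertex is a point. *)
Lemma edge_two_vertices : is_edge R alpha a I ->
  exists p q, [/\ p != q, p \notin I & q \notin I] /\
    forall k, k \notin I -> k = p \/ k = q.
Proof.
rewrite /is_edge => dim1; suff E2 : #|~: I| == 2%N.
  move/cards2P: E2 => [p [q [pq E]]].
  exists p, q; have memE k : (k \notin I) = (k == p) || (k == q).
    by rewrite -in_setC E !inE.
  rewrite !memE !eqxx orbT; split=> // k; rewrite memE.
  by case/orP => /eqP; [left | right].
rewrite eqn_leq; apply/andP; split; rewrite leqNgt; apply/negP.
  case/card_gt2P => k1 [k2 [k3 [[]]]]; rewrite !inE => h1 h2 h3 [n12 n23 n31].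
  pose e (k : 'I_d) := point R (U_(k) *+ alpha)%MM.
  have diff_in k l : k \notin I -> l \notin I -> e k - e l \in
     <<[seq point R x - point R y | x <- face, y <- face]>>%VS.
    by move=> kI lI; apply: memv_span; apply: allpairs_f; exact: face_vertex.
  have eE k l : e k ord0 l = if k == l then alpha%:R else 0.
    by rewrite pointE mulmnE mnm1E; case: eqP; rewrite ?mul1n.
  have al0 : (alpha%:R : R) != 0 by rewrite pnatr_eq0 -lt0n.
  clearbody e.
  have fr : free [:: e k1 - e k3; e k2 - e k3].
    rewrite free_cons seq1_free span_seq1; apply/andP; split.
      apply/vlineP => -[t /rowP/(_ k1)]; rewrite !mxE !eE eqxx.
      rewrite [k2 == k1]eq_sym (negbTE n12) (negbTE n31) subrr mulr0 subr0.
      exact/eqP.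
    apply/eqP => /rowP/(_ k2); rewrite !mxE !eE eqxx.
    by rewrite [k3 == k2]eq_sym (negbTE n23) subr0; apply/eqP.
  have : (<<[:: e k1 - e k3; e k2 - e k3]>> <=
    <<[seq point R x - point R y | x <- face, y <- face]>>)%VS.
    by apply/span_subvP => v; rewrite !inE => /orP[] /eqP ->; exact: diff_in.
  move=> /dimvS; move: fr; rewrite /free => /eqP ->.
  by rewrite [X in (_ <= X)%N]dim1.
rewrite ltnS => /card_le1_eqP J1.
have all_eq x y : x \in face -> y \in face -> x = y.
  move=> xf yf; have supp z k : z \in face -> k \in I -> z k = 0%N.
    by rewrite mem_filter => /andP[/forall_inP H _] kI; apply/eqP; exact: H.
  have val z k : z \in face -> k \notin I -> z k = alpha.
    move=> zf kI; rewrite -(face_deg zf) mdegE (bigD1 k) //= big1 ?addn0 // => l lk.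
    have [lI|lI] := boolP (l \in I); first exact: supp.
    by case/eqP: lk; apply: J1; rewrite inE.
  apply/mnmP => k; have [kI|kI] := boolP (k \in I); first by rewrite !supp.
  by rewrite !val.
have : (hull_dim R face <= 0)%N.
  rewrite /hull_dim leqn0 dimv_eq0 -subv0.
  apply/span_subvP => v /allpairsP[[x y] /= [xf yf ->]].
  by rewrite (all_eq x y) // subrr mem0v.
by rewrite dim1.
Qed.

Variables (p q : 'I_d).
Hypothesis pq : p != q.
Hypothesis pI : p \notin I.
Hypothesis qI : q \notin I.
Hypothesis pqP : forall k, k \notin I -> k = p \/ k = q.

Lemma face_supp x k : x \in face -> k != p -> k != q -> x k = 0%N.
Proof.
rewrite mem_filter => /andP[/forall_inP H _] /eqP kp /eqP kq.
apply/eqP/H; apply/negPn/negP => kI; by case: (pqP kI).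
Qed.

Lemma face_sum x : x \in face -> (x p + x q = alpha)%N.
Proof.
move=> xf; rewrite -(face_deg xf) mdegE (bigD1 p) //= (bigD1 q) 1?eq_sym //=.
by rewrite big1 ?addn0 // => k /andP[kp kq]; exact: face_supp.
Qed.

(** A lattice point of the segment is the convex combination of the two
    vertices with weights t / alpha and (alpha - t) / alpha. *)
Lemma full_edge_points (t : nat) : full_face R alpha a I -> (t <= alpha)%N ->
  (U_(p) *+ t + U_(q) *+ (alpha - t))%MM \in face.
Proof.
move=> full ta; apply/full; split.
  by rewrite mdegD !mdegMn !mdeg1 !mul1n subnKC.
pose ep := (U_(p) *+ alpha)%MM; pose eq := (U_(q) *+ alpha)%MM.
have epq : eq != ep.
  apply/eqP => /mnmP/(_ p); rewrite !mulmnE !mnm1E eqxx [q == p]eq_sym (negbTE pq); lia.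
have al0 : (alpha%:R : R) != 0 by rewrite pnatr_eq0 -lt0n.
pose w x : R := if x == ep then t%:R / alpha%:R else
  if x == eq then (alpha - t)%:R / alpha%:R else 0.
have wsum (V : lmodType R) (F : 'X_{1..d} -> V) :
    \sum_(x <- face) w x *: F x = (t%:R / alpha%:R) *: F ep
       + ((alpha - t)%:R / alpha%:R) *: F eq.
  rewrite (bigD1_seq ep) ?face_vertex ?face_uniq //= {1}/w eqxx; congr (_ + _).
  rewrite -big_filter (bigD1_seq eq) /=; last exact: filter_uniq face_uniq.
    rewrite {1}/w (negbTE epq) eqxx big_filter_cond big1 ?addr0 // => x /andP[h1 h2].
    by rewrite /w (negbTE h1) (negbTE h2) scale0r.
  by rewrite mem_filter epq face_vertex.
exists w; split.
- by move=> x _; rewrite /w; do 2?case: ifP => // _; rewrite divr_ge0 ?ler0n.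
- have := wsum R^o (fun=> 1); rewrite /GRing.scale /= !mulr1 -mulrDl -natrD subnKC //.
  rewrite divff // => <-; by apply: eq_bigr => x _; rewrite mulr1.
rewrite wsum; apply/rowP => k; rewrite !mxE !mnmDE !mulmnE !mnm1E natrD !natrM.
by congr (_ + _); rewrite mulrCA divfK // mulrC.
Qed.

End EdgeGeometry.

(** * Gaps on the given edge, and the bound *)

Section EdgeGaps.

Variables (R : realFieldType) (c n d : nat) (a : 'I_c -> 'X_{1..d.+1}).
Local Notation alpha := n.+1.
Hypothesis a_deg : forall i, mdeg (a i) = alpha.
Hypothesis gen_inj : injective (generator alpha a).

Lemma points_inj : injective a.
Proof.
by move=> i j E; apply/(@lshift_inj c d.+1)/gen_inj; rewrite !gen_point.
Qed.

Lemma points_nvertex i k : a i != (U_(k) *+ alpha)%MM.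
Proof.
apply/eqP; rewrite -(gen_point alpha) -(gen_vertex alpha a) => /gen_inj/eqP.
by rewrite eq_lrshift.
Qed.

Variable I : {set 'I_d.+1}.
Variables (q : 'I_d.+1) (p' : 'I_d).
Local Notation p := (lift q p').
Hypothesis qI : q \notin I.
Hypothesis pqP : forall k, k \notin I -> k = p \/ k = q.

Local Notation face := (face_points alpha a I).
Local Notation gaps := (gaps n a q p').

Let pq : p != q. Proof. by rewrite eq_sym neq_lift. Qed.

(** Among the residues in L the two vertices are identified, whence the
    summand 1; the map to residues is injective on the other points of the
    face. *)
Lemma size_face_gaps : (size face + gaps <= alpha + 1)%N.
Proof.
pose L := [set h : 'rV['I_n.+1]_d | zero_at p' h == 0].
have LE : (#|L :&: taken n a q| + gaps = #|L|)%N.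
  rewrite -(cardsID (taken n a q) L); congr (_ + _)%N.
  by apply: eq_card => h; rewrite !inE andbC.
have cL : (#|L| <= alpha)%N.
  have inj : {in L &, injective (fun h : 'rV['I_n.+1]_d => h ord0 p')}.
    move=> h1 h2; rewrite !inE => /eqP E1 /eqP E2 E.
    by rewrite -(set_atK p' h1) -(set_atK p' h2) E E1 E2.
  by rewrite -[leqRHS]card_ord -(card_in_imset inj) max_card.
suff : (size face <= (#|L :&: taken n a q|).+1)%N by lia.
pose eq := (U_(q) *+ alpha)%MM.
have eq_face : eq \in face by exact: face_vertex.
have fu := face_uniq gen_inj I.
rewrite (perm_size (perm_to_rem eq_face)) /= ltnS cardE -(size_map (res n q)).
have fs := face_sum a_deg pq pqP.
have f0 x k : x \in face -> k != p -> k != q -> x k = 0%N by exact: (face_supp pqP).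
have remP x : x \in rem eq face -> x \in face /\ (0 < x p)%N.
  rewrite rem_filter // mem_filter => /andP[/= xe xf]; split=> //.
  rewrite lt0n; apply: contra xe => /eqP xp; apply/eqP/mnmP => k.
  rewrite /eq mulmnE mnm1E; have [<-|kq] := eqVneq q k.
    by have := fs x xf; rewrite xp mul1n.
  rewrite mul0n; have [->//|kp] := eqVneq k p; apply: f0 => //.
  by rewrite eq_sym.
apply: uniq_leq_size.
  rewrite map_inj_in_uniq ?rem_uniq // => x y /remP[xf xp] /remP[yf yp].
  move=> /rowP/(_ p')/(congr1 val); rewrite !mxE /= => E.
  have [sx sy] := (fs x xf, fs y yf).
  have xy : x p = y p.
    move: E; have [->|xa] := eqVneq (x p) alpha; have [->|ya] := eqVneq (y p) alpha => //.
    - by rewrite modnn modn_small; lia.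
    - by rewrite modnn modn_small; lia.
    - by rewrite !modn_small //; lia.
  apply/mnmP => k; have [->//|kp] := eqVneq k p.
  have [->|kq] := eqVneq k q; first by lia.
  by rewrite !f0.
move=> _ /mapP[x /remP[xf xp] ->]; rewrite mem_enum in_setI; apply/andP; split.
  rewrite inE; apply/eqP/rowP => k; apply: val_inj; rewrite !mxE.
  case: eqP => // /eqP kp /=; rewrite f0 ?mod0n //.
    by rewrite (inj_eq (@lift_inj _ q)).
  by rewrite eq_sym neq_lift.
move: xf; rewrite mem_filter => /andP[_ /codomP[v ->]].
rewrite -(splitK v); case: (split v) => [i|k] /=; rewrite /taken inE; apply/orP.
  by right; rewrite gen_point; apply/imsetP; exists i.
left; rewrite inE gen_vertex; apply/eqP/rowP => l; apply: val_inj.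
by rewrite !mxE /= mulmnE modnMl.
Qed.

Hypothesis pI : p \notin I.

Lemma full_no_gaps : full_face R alpha a I -> gaps = 0%N.
Proof.
move=> full; apply/eqP; rewrite cards_eq0; apply/eqP/setP => h.
rewrite in_set0 in_set; apply/negP => /andP[/eqP h0].
have hE : h = set_at p' 0 (h ord0 p').
  by rewrite -{1}(set_atK p' h) [zero_at p' h]h0.
apply/negP; rewrite negbK; have [x0|x0] := posnP (h ord0 p').
  suff -> : h = 0 by rewrite /taken setU11.
  rewrite hE; apply/rowP => k; rewrite !mxE; case: eqP => // _.
  by apply: val_inj.
have := full_edge_points (ltn0Sn n) gen_inj pq pI qI full (ltnW (ltn_ord (h ord0 p'))).
rewrite mem_filter => /andP[_ /codomP[v]].
rewrite -(splitK v); case: (split v) => [i|k] /=; last first.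
  rewrite gen_vertex => /mnmP/(_ p); rewrite !mnmDE !mulmnE !mnm1E eqxx.
  rewrite (negbTE (neq_lift q p')); have := ltn_ord (h ord0 p').
  by move: (nat_of_ord _) x0 => y y0 yn E; exfalso; move: E; case: (k == p); lia.
rewrite gen_point => E; rewrite /taken inE; apply/orP; right.
apply/imsetP; exists i => //; rewrite -E hE; apply/rowP => k; apply: val_inj.
rewrite !mxE /= mnmDE !mulmnE !mnm1E (negbTE (neq_lift q k)) mul0n addn0.
rewrite (inj_eq (@lift_inj _ q)) eq_sym; case: eqP => _ /=; last by rewrite mod0n.
by rewrite mul1n eqxx modn_small.
Qed.

End EdgeGaps.

Theorem proposition2p6 (K : fieldType) (R : realFieldType) (c d alpha : nat)
    (a : 'I_c -> 'X_{1..d}) (degKS codimKS : nat)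
    (c_ge2 : (2 <= c)%N) (alpha_ge2 : (2 <= alpha)%N)
    (a_in_M : forall i, mdeg (a i) = alpha)
    (A_distinct : injective (generator alpha a))
    (a_coprime :
       \big[gcdn/0%N]_(i < c) \big[gcdn/0%N]_(j < d) a i j = 1%N)
    (deg_def : multiplicity (toric_ideal K alpha a) degKS)
    (codim_def : codim (toric_ideal K alpha a) codimKS)
    (deg_max : degKS = (alpha ^ (d - 1))%N)
    (edge : exists2 I : {set 'I_d}, is_edge R alpha a I &
       full_face R alpha a I \/
       (3 / 4 + 1 / (4 * d%:R)) * alpha%:R + 2
         <= (size (face_points alpha a I))%:R :> rat) :
  exists2 D : nat, max_groebner_degree (toric_ideal K alpha a) D &
    D%:Z <= degKS%:Z - codimKS%:Z + 1.
Proof.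
have codim_c := codim_le (ltnW alpha_ge2) codim_def.
case: alpha alpha_ge2 a_in_M A_distinct edge {codim_def deg_def} deg_max => // n.
rewrite ltnS => n_gt0 a_deg gen_inj [I edgeI edge_pts] ->.
have [p [q [[pq pI qI] pqP]]] := edge_two_vertices (ltn0Sn n) a_deg edgeI.
case: d p q I a a_deg gen_inj edgeI edge_pts pq pI qI pqP {a_coprime} => [[]//|d].
move=> p q I a a_deg gen_inj edgeI edge_pts pq pI qI pqP.
rewrite subSS subn0.
have qp : q != p by rewrite eq_sym.
have [p' Ep _] := unlift_some qp.
subst p.
have a_inj := points_inj gen_inj; have a_nv := points_nvertex gen_inj.
have gapsP : gaps n a q p' = 0%N \/ (4 * (gaps n a q p').+1 < n.+1)%N.
  case: edge_pts => [full|many]; first by left; exact: full_no_gaps full.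
  right; have := size_face_gaps a_deg gen_inj qI pqP.
  move: (gaps n a q p') => g; rewrite -(ler_nat rat) !natrD => sz.
  have pos : 0 < 1 / (4 * d.+1%:R) * n.+1%:R :> rat.
    by rewrite mulr_gt0 // divr_gt0 // mulr_gt0.
  move: many sz pos; rewrite -(ltr_nat rat) natrM -[g.+1]addn1 natrD mulrDl.
  have arith (x N s g' : rat) : 3 / 4 * N + x + 2 <= s -> s + g' <= N + 1 ->
    0 < x -> 4 * (g' + 1) < N by move=> *; lra.
  exact: arith.
have irr_size s : ~ reducible n.+1 a s -> (size s + c <= n.+1 ^ d)%N.
  exact: (irreducible_size q a_deg a_inj a_nv).
have irr_pair s s' (v v' : 'X_{1..d.+1}) k k' :
  ~ reducible n.+1 a s -> ~ reducible n.+1 a s' ->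
  (\sum_(i <- s) a i + v *+ n.+1 = \sum_(i <- s') a i + v' *+ n.+1)%MM ->
  (0 < v k)%N -> v' k = 0%N -> v k' = 0%N -> (0 < v' k')%N ->
  (size s + size s' + c <= n.+1 ^ d + 2)%N.
  move=> irr irr' E vk v'k vk' v'k'.
  (* a third coordinate exists unless the simplex is a segment *)
  have [k0 /= k0p|no] := pickP (fun k0 : 'I_d => k0 != p').
    have := irreducible_size_edge n_gt0 a_deg a_inj a_nv k0p gapsP irr.
    have := irreducible_size_edge n_gt0 a_deg a_inj a_nv k0p gapsP irr'.
    lia.
  have d1 : d = 1%N.
    by apply/eqP; rewrite -[d]card_ord; apply/fintype1P; exists p' => j;
       apply/eqP/negbFE/no.
  have kk' : k != k' by apply: contraTneq vk => ->; rewrite vk'.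
  have kk'P j : j = k \/ j = k'.
    have [->|jk] := eqVneq j k; first by left.
    have [->|jk'] := eqVneq j k'; first by right.
    have := max_card (mem [set j; k; k']).
    rewrite card_ord -setUA cardsU1 cards2 kk' !inE (negbTE jk) (negbTE jk'); lia.
  have cu := card_untaken q a_deg a_inj a_nv.
  have gE : gaps n a q p' = #|~: taken n a q|.
    have z0 h : zero_at p' h = 0.
      by apply/rowP => j; rewrite !mxE; have /negbFE -> := no j.
    by apply: eq_card => h; rewrite in_set in_setC /= z0 eqxx.
  have gc : (gaps n a q p' + c.+1 = n.+1)%N by rewrite gE cu d1 expn1.
  have ga : (4 * gaps n a q p' < n.+1)%N by case: gapsP; lia.
  have := two_coordinates_short a_deg a_inj a_nv kk' kk'P irr irr' E vk v'k vk' v'k' gc ga.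
  by have := irr_size _ irr; have := irr_size _ irr'; lia.
have i0 : 'I_c by exact: Ordinal (ltnW c_ge2).
have [|D gD le] := @max_groebner_degree_exists K c d.+1 n.+1 a (ltn0Sn n) a_deg i0
  (n.+1 ^ d + 1 - c)%N.
  move=> m nm mm.
  by have := minimal_nonstandard_degree (ltn0Sn n) a_deg irr_size irr_pair nm mm; lia.
exists D => //.
have cN : (c <= n.+1 ^ d)%N.
  have [|H] := classic (reducible n.+1 a [::]); last by have := irr_size _ H.
  case=> f [v [v0]]; rewrite big_nil => /(congr1 mdeg).
  rewrite mdeg0 mdegD mdegMn => /esym/eqP.
  by rewrite addn_eq0 muln_eq0 !mdeg_eq0 (negbTE v0) andbF.
lia.
Qed.
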